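(* Let $G$ be a connected Lie group equipped with both a left-invariant Riemannian metric $\langle\cdot,\cdot\rangle$ and a bi-invariant Riemannian metric $\langle\cdot,\cdot\rangle_{\mathrm{Bi}}$, and let $\beta:\mathfrak g\to\mathfrak g$ be the linear endomorphism such that $\langle\xi,\eta\rangle_{\mathrm{Bi}} = \langle\beta(\xi),\eta\rangle$ for all $\xi,\eta\in\mathfrak g$. Let $V: G \to \mathbb{R}$ be a smooth non-negative function, and suppose there exist $g_0 \in G$ and a smooth function $V_{\mathrm{ext}}: G \times G \to \mathbb{R}$ with $V_{\mathrm{ext}}(\cdot, g_0) = V$ and $V_{\mathrm{ext}}(hg, h\bar g) = V_{\mathrm{ext}}(g, \bar g)$ for all $g, \bar g, h \in G$. Let $g \in \Omega$. Then $g$ solves $$D_t^3 \dot g + R(D_t \dot g, \dot g)\dot g + \mathrm{grad}\, V(g(t)) = 0 \quad \text{on } [a,b]$$ if and only if $\xi := g^{-1}\dot g$ and $h := g_0^{-1} g$ solve \begin{align*} \dot\xi &= \eta + \mathrm{ad}^\dagger_\xi \xi, \\ 0 &= \ddot\eta + 2\nabla^{\mathfrak g}_\xi \dot\eta + \nabla^{\mathfrak g}_\eta \eta + \nabla^{\mathfrak g}_{\mathrm{ad}^\dagger_\xi \xi}\eta + \nabla^{\mathfrak g}_\xi \nabla^{\mathfrak g}_\xi \eta + R(\eta, \xi)\xi + \beta\big((L_{h^{-1}})_* \,\mathrm{grad}_1^{\mathrm{Bi}} V_{\mathrm{ext}}(h, e)\big), \\ \dot h &= (L_h)_* \xi ,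 \end{align*} where $\mathrm{grad}_1^{\mathrm{Bi}} V_{\mathrm{ext}}(h,e)$ denotes the gradient of $V_{\mathrm{ext}}$ with respect to its first argument and the metric $\langle\cdot,\cdot\rangle_{\mathrm{Bi}}$.
   Context: $G$ has identity $e$ and Lie algebra $\mathfrak g = T_eG$; $L_g(h) = gh$; for $X \in T_hG$, $gX := (L_g)_*X$, so $g^{-1}\dot g$ is a curve in $\mathfrak g$. All of $\nabla$ (Levi-Civita connection), $D_t$ (covariant derivative along curves), $R(X,Y)Z = \nabla_X\nabla_Y Z - \nabla_Y\nabla_X Z - \nabla_{[X,Y]}Z$ (evaluated at $e$ on elements of $\mathfrak g$), $\mathrm{grad}$, and $\mathrm{ad}^\dagger$ are taken with respect to the left-invariant metric $\langle\cdot,\cdot\rangle$. For $\xi\in\mathfrak g$, $\phi(\xi)(g) = (L_g)_*\xi$. The Riemannian $\mathfrak g$-connection is $\nabla^{\mathfrak g}_\xi\eta := (\nabla_{\phi(\xi)}\phi(\eta))(e)$, applied pointwise in $t$ to curves in $\mathfrak g$. $\mathrm{ad}^\dagger_\xi\eta := (\mathrm{ad}^*_\xi \eta^\flat)^\sharp$, i.e. $\langle \mathrm{ad}^\dagger_\xi\eta, \zeta\rangle = \langle \eta, [\xi,\zeta]\rangle$ for all $\zeta\in\mathfrak g$. Given $a<b$ and boundary data $(q_a,v_a),(q_b,v_b)\in TG$, $\Omega$ is the set of $C^1$, piecewise smooth curves $g:[a,b]\to G$ with $g(a)=q_a$, $g(b)=q_b$, $\dot g(a)=v_a$, $\dot g(b)=v_b$.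 Solutions of the displayed equation are understood to be $C^\infty$ curves on $[a,b]$. *)

(* Defs.v *)
From HB Require Import structures.
From mathcomp Require Import all_boot all_order all_algebra.
From mathcomp Require Import all_classical all_reals all_analysis.

Set Implicit Arguments.
Unset Strict Implicit.
Unset Printing Implicit Defensive.

Import Order.TTheory GRing.Theory Num.Theory.
Import numFieldNormedType.Exports.

Local Open Scope classical_set_scope.
Local Open Scope ring_scope.

(* For open [U]; [k.+1]-times continuous differentiability is expressed by
   partial derivatives. *)
Fixpoint Ck (R : realType) (n k : nat) (U : set 'rV[R]_n) (f : 'rV[R]_n -> R)
    : Prop :=
  (forall x, U x -> {for x, continuous f}) /\
  if k is k'.+1 then
    forall i : 'I_n, (forall x, U x -> derivable f x (delta_mx 0 i)) /\
      Ck k' U (fun x => 'D_(delta_mx 0 i) f x)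
  else True.

Definition smooth_rV (R : realType) (n : nat) (U : set 'rV[R]_n)
  (f : 'rV[R]_n -> R) : Prop := forall k, Ck k U f.

(* [D] is typically (a relatively open subset of) an interval; at an endpoint of
   [a, b] the derivative within [D] is the one-sided derivative. *)
Definition derivable_within (R : realType) (D : set R) (f : R -> R) (t : R)
  : Prop := cvg ((fun s => (f s - f t) / (s - t)) @ within (D `\ t) (nbhs t)).

Definition derive_within (R : realType) (D : set R) (f : R -> R) (t : R) : R :=
  lim ((fun s => (f s - f t) / (s - t)) @ within (D `\ t) (nbhs t)).

Fixpoint Ck_within (R : realType) (k : nat) (D : set R) (f : R -> R) : Prop :=
  {within D, continuous f} /\
  if k is k'.+1 then
    (forall t, D t -> derivable_within D f t) /\
    Ck_within k' D (derive_within D f)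
  else True.

Definition smooth_within (R : realType) (D : set R) (f : R -> R) : Prop :=
  forall k, Ck_within k D f.

Record chart (R : realType) (n : nat) (M : topologicalType) := Chart {
  chart_dom : set M;
  chart_img : set 'rV[R]_n;
  chart_map : M -> 'rV[R]_n;
  chart_inv : 'rV[R]_n -> M;
  chart_dom_open : open chart_dom;
  chart_img_open : open chart_img;
  chart_map_img : forall p, chart_dom p -> chart_img (chart_map p);
  chart_inv_dom : forall x, chart_img x -> chart_dom (chart_inv x);
  chart_mapK : forall p, chart_dom p -> chart_inv (chart_map p) = p;
  chart_invK : forall x, chart_img x -> chart_map (chart_inv x) = x;
  chart_map_continuous : forall p, chart_dom p -> {for p, continuous chart_map};
  chart_inv_continuous : forall x, chart_img x -> {for x, continuous chart_inv}
}.

HB.mixin Record isSmoothManifold (R : realType) (n : nat) M of Topological M := {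
  atlas : set (chart R n M);
  atlas_cover : forall p : M, exists2 c, atlas c & chart_dom c p;
  atlas_compat : forall c d, atlas c -> atlas d -> forall i : 'I_n,
    smooth_rV [set x | chart_img c x /\ chart_dom d (chart_inv c x)]
              (fun x => chart_map d (chart_inv c x) 0 i);
  manifold_hausdorff : hausdorff_space M;
  manifold_second_countable : @second_countable M
}.

#[short(type="smoothManifoldType")]
HB.structure Definition SmoothManifold (R : realType) (n : nat) :=
  {M of isSmoothManifold R n M & Topological M}.

Section Smooth.
Context {R : realType} {n : nat} {M : smoothManifoldType R n}.

(* For open [U]; the values of [f] outside [U] are irrelevant. *)
Definition smooth_on (U : set M) (f : M -> R) : Prop :=
  forall c : chart R n M, atlas c ->
    smooth_rV [set x | chart_img c x /\ U (chart_inv c x)]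
              (fun x => f (chart_inv c x)).

Definition smooth_near (p : M) (f : M -> R) : Prop :=
  exists U, [/\ open U, U p & smooth_on U f].

Definition smooth_fun (f : M -> R) : Prop := smooth_on setT f.

(* Smoothness on an open subset of the product manifold M * N, whose charts are
   the products of a chart of M and a chart of N. *)
Definition smooth_on_prod {m : nat} {N : smoothManifoldType R m}
    (W : set (M * N)) (F : M * N -> R) : Prop :=
  forall (c : chart R n M) (d : chart R m N), atlas c -> atlas d ->
    let inv (z : 'rV[R]_(n + m)) :=
      (chart_inv c (lsubmx z), chart_inv d (rsubmx z)) in
    smooth_rV [set z | [/\ chart_img c (lsubmx z), chart_img d (rsubmx z)
                         & W (inv z)]]
              (fun z => F (inv z)).

Definition Ck_curve (k : nat) (D : set R) (g : R -> M) : Prop :=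
  {within D, continuous g} /\
  forall c : chart R n M, atlas c -> forall i : 'I_n,
    Ck_within k (D `&` g @^-1` chart_dom c) (fun t => chart_map c (g t) 0 i).

Definition smooth_curve (D : set R) (g : R -> M) : Prop :=
  forall k, Ck_curve k D g.

Definition piecewise_smooth (a b : R) (g : R -> M) : Prop :=
  exists2 s : seq R, itv_partition a b s &
    forall i, (i < size s)%N ->
      smooth_curve `[nth b (a :: s) i, nth b (a :: s) i.+1] g.

End Smooth.

HB.mixin Record isLieGroup (R : realType) (n : nat) G
    of SmoothManifold R n G & Group G := {
  mulg_continuous : continuous (fun x : G * G => (x.1 * x.2)%g);
  mulg_smooth : forall c : chart R n G, atlas c -> forall i : 'I_n,
    smooth_on_prod [set x : G * G | chart_dom c (x.1 * x.2)%g]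
                   (fun x => chart_map c (x.1 * x.2)%g 0 i);
  invg_continuous : continuous (fun x : G => (x^-1)%g);
  invg_smooth : forall c : chart R n G, atlas c -> forall i : 'I_n,
    smooth_on [set x : G | chart_dom c (x^-1)%g]
              (fun x => chart_map c (x^-1)%g 0 i)
}.

#[short(type="lieGroupType")]
HB.structure Definition LieGroup (R : realType) (n : nat) :=
  {G of isLieGroup R n G & SmoothManifold R n G & Group G}.

(* A tangent vector at p is the class of a smooth curve through p, two curves
   being identified when they differentiate alike all functions smooth near p.
   Such a class is the functional f |-> (f o g)'(0); to make equality of classes
   Leibniz equality of functionals, the functional is set to 0 on the functions
   that are not smooth near p. Sums and multiples are those of functionals. *)
Notation tvec R M := ((M -> R) -> R) (only parsing).

Section Tangent.
Context {R : realType} {n : nat} {M : smoothManifoldType R n}.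
Implicit Types (p : M) (u v w : tvec R M) (X Y Z : M -> tvec R M).

Definition on_germs p (v : tvec R M) : tvec R M :=
  fun f => if `[< smooth_near p f >] then v f else 0.

Definition velocity (D : set R) (g : R -> M) (t : R) : tvec R M :=
  on_germs (g t) (fun f => derive_within D (f \o g) t).

Definition tangent p : set (tvec R M) :=
  [set v | exists (e : R) (g : R -> M), [/\ 0 < e,
    smooth_curve `]- e, e[%classic g, g 0 = p &
    v = velocity `]- e, e[%classic g 0]].

Definition vector_field X : Prop :=
  (forall p, tangent p (X p)) /\
  (forall U f, open U -> smooth_on U f -> smooth_on U (fun p => X p f)).

Definition Omega (a b : R) (qa : M) (va : tvec R M) (qb : M) (vb : tvec R M)
    : set (R -> M) :=
  [set g | [/\ Ck_curve 1 `[a, b] g, piecewise_smooth a b g,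
               g a = qa, g b = qb &
               velocity `[a, b] g a = va /\ velocity `[a, b] g b = vb]].

Definition bracket X Y : M -> tvec R M := fun p =>
  on_germs p (fun f => X p (fun q => Y q f) - Y p (fun q => X q f)).

Definition field_along (D : set R) (g : R -> M) (W : R -> tvec R M) : Prop :=
  (forall t, D t -> tangent (g t) (W t)) /\
  (forall U f, open U -> smooth_on U f ->
     smooth_within (D `&` g @^-1` U) (fun t => W t f)).

(* Smooth curves in the fixed finite-dimensional vector space T_p M, and their
   derivative. *)
Definition curve_in_tangent (D : set R) p (c : R -> tvec R M) : Prop :=
  (forall t, D t -> tangent p (c t)) /\
  (forall f, smooth_near p f -> smooth_within D (fun t => c t f)).

Definition deriv_vec (D : set R) (c : R -> tvec R M) (t : R) : tvec R M :=
  fun f => derive_within D (fun s => c s f) t.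

Definition riemannian_metric (met : M -> tvec R M -> tvec R M -> R) : Prop :=
  [/\ forall p u v, tangent p u -> tangent p v -> met p u v = met p v u,
      forall p (r : R) u v w, tangent p u -> tangent p v -> tangent p w ->
        met p (r *: u + v) w = r * met p u w + met p v w,
      forall p u, tangent p u -> u != 0 -> 0 < met p u u &
      forall X Y, vector_field X -> vector_field Y ->
        smooth_fun (fun p => met p (X p) (Y p))].

Definition grad (met : M -> tvec R M -> tvec R M -> R) (f : M -> R) p
    : tvec R M :=
  xget 0 [set v | tangent p v /\ forall w, tangent p w -> met p v w = w f].

(* [nabla X Y] is nabla_X Y. *)
Definition affine_connection
    (nabla : (M -> tvec R M) -> (M -> tvec R M) -> (M -> tvec R M)) : Prop :=
  [/\ forall X Y, vector_field X -> vector_field Y -> vector_field (nabla X Y),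
      forall X1 X2 Y, vector_field X1 -> vector_field X2 -> vector_field Y ->
        nabla (X1 + X2) Y = nabla X1 Y + nabla X2 Y,
      forall f X Y, smooth_fun f -> vector_field X -> vector_field Y ->
        nabla (fun p => f p *: X p) Y = (fun p => f p *: nabla X Y p),
      forall X Y1 Y2, vector_field X -> vector_field Y1 -> vector_field Y2 ->
        nabla X (Y1 + Y2) = nabla X Y1 + nabla X Y2 &
      forall f X Y, smooth_fun f -> vector_field X -> vector_field Y ->
        nabla X (fun p => f p *: Y p)
        = (fun p => X p f *: Y p + f p *: nabla X Y p)].

Definition levi_civita (met : M -> tvec R M -> tvec R M -> R)
    (nabla : (M -> tvec R M) -> (M -> tvec R M) -> (M -> tvec R M)) : Prop :=
  [/\ affine_connection nabla,
      forall X Y, vector_field X -> vector_field Y ->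
        nabla X Y - nabla Y X = bracket X Y &
      forall X Y Z, vector_field X -> vector_field Y -> vector_field Z ->
        forall p, X p (fun q => met q (Y q) (Z q))
          = met p (nabla X Y p) (Z p) + met p (Y p) (nabla X Z p)].

Definition curvature
    (nabla : (M -> tvec R M) -> (M -> tvec R M) -> (M -> tvec R M)) X Y Z
    : M -> tvec R M :=
  nabla X (nabla Y Z) - nabla Y (nabla X Z) - nabla (bracket X Y) Z.

(* The value on vectors u, v, w at p is that of the curvature on any extensions
   of u, v, w to vector fields; it does not depend on them by tensoriality. *)
Definition curvature_at
    (nabla : (M -> tvec R M) -> (M -> tvec R M) -> (M -> tvec R M)) p u v w
    : tvec R M :=
  xget 0 [set z | exists X Y Z,
    [/\ vector_field X, vector_field Y & vector_field Z] /\
    [/\ X p = u, Y p = v, Z p = w & z = curvature nabla X Y Z p]].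

(* [Dt g W] is the covariant derivative D_t W of a field W along the smooth curve
   g : D -> M. It is the unique operator with the properties below. In the last
   one, nabla X Y (g t) is nabla_{g'(t)} Y, which only depends on X (g t). *)
Definition covariant_derivative
    (nabla : (M -> tvec R M) -> (M -> tvec R M) -> (M -> tvec R M))
    (D : set R) (Dt : (R -> M) -> (R -> tvec R M) -> (R -> tvec R M)) : Prop :=
  forall g, smooth_curve D g ->
  [/\ forall W, field_along D g W -> field_along D g (Dt g W),
      forall W1 W2, field_along D g W1 -> field_along D g W2 ->
        forall t, D t -> Dt g (W1 + W2) t = Dt g W1 t + Dt g W2 t,
      forall (f : R -> R) W, smooth_within D f -> field_along D g W ->
        forall t, D t -> Dt g (fun s => f s *: W s) t
          = derive_within D f t *: W t + f t *: Dt g W t &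
      forall W Y, field_along D g W -> vector_field Y ->
        (forall t, D t -> W t = Y (g t)) ->
        forall X t, D t -> vector_field X -> X (g t) = velocity D g t ->
          Dt g W t = nabla X Y (g t)].

End Tangent.

Section LieGroupDefs.
Context {R : realType} {n : nat} {G : lieGroupType R n}.
Implicit Types (p x : G) (u v xi eta zeta : tvec R G).

(* The differentials of the translations h |-> x h and h |-> h x. *)
Definition Lpush x v : tvec R G := fun f => v (fun y => f (x * y)%g).
Definition Rpush x v : tvec R G := fun f => v (fun y => f (y * x)%g).

Definition left_invariant (met : G -> tvec R G -> tvec R G -> R) : Prop :=
  forall x p u v, tangent p u -> tangent p v ->
    met (x * p)%g (Lpush x u) (Lpush x v) = met p u v.

Definition right_invariant (met : G -> tvec R G -> tvec R G -> R) : Prop :=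
  forall x p u v, tangent p u -> tangent p v ->
    met (p * x)%g (Rpush x u) (Rpush x v) = met p u v.

Definition lie_algebra : set (tvec R G) := tangent (1%g : G).

Definition left_field xi : G -> tvec R G := fun x => Lpush x xi.

Definition lie_bracket xi eta : tvec R G :=
  bracket (left_field xi) (left_field eta) 1%g.

Definition nabla_lie
    (nabla : (G -> tvec R G) -> (G -> tvec R G) -> (G -> tvec R G)) xi eta
    : tvec R G := nabla (left_field xi) (left_field eta) 1%g.

Definition ad_dagger (met : G -> tvec R G -> tvec R G -> R) xi eta : tvec R G :=
  xget 0 [set z | lie_algebra z /\
    forall zeta, lie_algebra zeta ->
      met 1%g z zeta = met 1%g eta (lie_bracket xi zeta)].

Definition lie_endomorphism (beta : tvec R G -> tvec R G) : Prop :=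
  (forall xi, lie_algebra xi -> lie_algebra (beta xi)) /\
  (forall (r : R) xi eta, lie_algebra xi -> lie_algebra eta ->
    beta (r *: xi + eta) = r *: beta xi + beta eta).

End LieGroupDefs.

(* Main.v *)
Require Import Defs.
From HB Require Import structures.
From mathcomp Require Import all_boot all_order all_algebra.
From mathcomp Require Import all_classical all_reals all_analysis.
From mathcomp Require Import ring lra.

Set Implicit Arguments.
Unset Strict Implicit.
Unset Printing Implicit Defensive.

Import Order.TTheory GRing.Theory Num.Theory.
Import numFieldNormedType.Exports.

Local Open Scope classical_set_scope.
Local Open Scope ring_scope.

(* Everything is read in the left trivialization, where every vector along [g] is
   written g(t) w(t) with w a curve in the Lie algebra. For a left-invariant metric the
   Koszul formula shows that the Levi-Civita connection of left-invariant fields is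
   left-invariant, so that D_t (g w) = g (w' + nabla_xi w) with xi = g^-1 g', and that
   nabla_xi xi = - ad^dagger_xi xi. With eta = xi' - ad^dagger_xi xi this gives
   D_t g' = g eta, and two more applications and the product rule give D_t^3 g'. The
   curvature is left-invariant by the same token. As V(x) = Vext(g0^-1 x, 1), the Riesz
   vectors of dV for the two metrics, translated to the identity, differ by [beta]. *)

(** * Differentiability along quotient filters *)

(** Two notions of smoothness meet: iterated partial derivatives in charts, and derivatives within
    [a, b], one-sided at its ends, for curves. A chain rule has to lead from the first to the
    second. Both are therefore made instances of one structure of difference quotients along
    filters, in which sums, products and compositions with C^k functions are treated once.

    The other obstacle is that the connection and [Dt] are known only through axioms about global
    vector fields, and the curvature only through global extensions. Cut-off functions would be the
    usual remedy. On a Lie group the left-invariant fields form a global frame, and for a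
    left-invariant metric its Gram matrix is constant. Every vector field is thus a finite
    combination of frame fields with smooth coefficients, so tensoriality needs no localization, and
    [Dt] is determined by its values on left-invariant fields and the Leibniz rule.

    Smoothness of the curve is asserted on both sides of the equivalence and passes between [g] and
    [h] by translation. The curve [eta], though existentially quantified, is forced on [a, b] by the
    first equation of the system. *)

Lemma MVT_origin (R : realType) (f df : R -> R) (d : R) :
  (forall s : R, `|s| <= `|d| -> is_derive s 1 f (df s)) ->
  exists2 c, `|c| <= `|d| & f d - f 0 = df c * d.
Proof.
move=> fd; have cont (u v : R) : (forall s : R, u <= s <= v -> `|s| <= `|d|) ->
    {within `[u, v], continuous f}.
  move=> uv; apply: derivable_within_continuous => s; rewrite in_itv/= => suv.
  by have [] := fd s (uv s suv).
have [d0|d0] := leP 0 d.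
  have le s : 0 <= s <= d -> `|s| <= `|d|.
    by move=> /andP[s0 sd]; rewrite !ger0_norm.
  have [s|c] := @MVT_segment _ f df _ _ d0 _ (cont _ _ le).
    by rewrite in_itv/= => /andP[s0 sd]; apply/fd/le; rewrite !ltW.
  by rewrite in_itv/= => /le cd; rewrite subr0; exists c.
have le s : d <= s <= 0 -> `|s| <= `|d|.
  by move=> /andP[s0 sd]; rewrite !ler0_norm ?lerN2// ltW.
have [s|c] := @MVT_segment _ f df _ _ (ltW d0) _ (cont _ _ le).
  by rewrite in_itv/= => /andP[s0 sd]; apply/fd/le; rewrite !ltW.
rewrite in_itv/= => /le cd cE; exists c => //.
by rewrite -opprB cE sub0r mulrN opprK.
Qed.

Section Frechet.
Context {R : realType} {n : nat}.
Implicit Types (phi : 'rV[R]_n -> R) (x y z : 'rV[R]_n).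

Lemma is_derive_line phi z (v : 'rV[R]_n) (s : R) :
  derivable phi (s *: v + z) v ->
  is_derive s 1 (fun t : R => phi (t *: v + z)) ('D_v phi (s *: v + z)).
Proof.
move=> d; have E : (fun h : R => h^-1 *: (((fun t : R =>
  phi (t *: v + z)) \o shift s) (h *: (1 : R)) - phi (s *: v + z)))
  = (fun h : R => h^-1 *: ((phi \o shift (s *: v + z)) (h *: v) - phi (s *: v +
    z))).
  by apply: funext => h /=; rewrite [_%:A]mulr1 scalerDl addrA.
by split; [move: d; rewrite /derivable E|rewrite /derive E].
Qed.

(** Going from [y] to [z] one coordinate at a time, the mean value theorem turns each increment of
    [phi] into a coordinate increment times a partial derivative at a nearby point, which continuity
    keeps within [e] of the one at [y]. *)
Lemma C1_frechet phi y :
  (forall i, \forall z \near y, derivable phi z (delta_mx 0 i)) ->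
  (forall i, {for y, continuous (fun z => 'D_(delta_mx 0 i) phi z)}) ->
  forall e : R, 0 < e -> \forall z \near y,
    `|phi z - phi y - \sum_i (z 0 i - y 0 i) * 'D_(delta_mx 0 i) phi y|
      <= e * \sum_i `|z 0 i - y 0 i|.
Proof.
move=> dphi cphi e e0.
have : \forall z \near y, forall i, derivable phi z (delta_mx 0 i) /\
    `|'D_(delta_mx 0 i) phi y - 'D_(delta_mx 0 i) phi z| <= e.
  apply: (filter_forall (F := nbhs y)) => i;
    have /cvgrPdist_le/(_ e e0) := cphi i.
  by move: (dphi i); apply: filterS2 => z.
move=> /nbhs_ballP[d d0 dP]; apply/nbhs_ballP; exists d => // z [_ yz].
(* The corners of the broken line from [y] to [z]: [p 0] is [y], [p n] is [z], and [p i.+1] differs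
   from [p i] in coordinate [i] only. Balls of row vectors are boxes, so the whole line stays in the
   ball. *)
pose p (k : nat) : 'rV[R]_n := \row_j (if (j < k)%N then z 0 j else y 0 j).
have -> : phi z - phi y = \sum_(i < n) (phi (p i.+1) - phi (p i)).
  rewrite -(big_mkord xpredT (fun k => phi (p k.+1) - phi (p k))).
  rewrite telescope_sumr//; congr (phi _ - phi _); apply/rowP => j.
    by rewrite mxE ltn_ord.
  by rewrite mxE ltn0.
rewrite -sumrB mulr_sumr; apply: (le_trans (ler_norm_sum _ _ _)).
apply: ler_sum => i _.
pose w := z 0 i - y 0 i.
have yzi : `|w| < d.
  by have := yz 0 i; rewrite /ball/= distrC.
have inb s : `|s| <= `|w| -> ball y d (s *: delta_mx 0 i + p i).
  move=> sw; split => // k j; rewrite ord1 !mxE !eqxx/=.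
  have [->|ji] := eqVneq j i.
    rewrite ltnn mulr1 /ball/= [X in `|X|](_ : _ = - s); last by ring.
    by rewrite normrN (le_lt_trans sw).
  by rewrite mulr0 add0r; case: ifP => _; [exact: yz|exact: ballxx].
have [|c cw] := @MVT_origin R (fun t : R => phi (t *: delta_mx 0 i + p i))
    (fun t => 'D_(delta_mx 0 i) phi (t *: delta_mx 0 i + p i)) w.
  by move=> s sw; apply: is_derive_line; have [] := dP _ (inb s sw) i.
have -> : w *: delta_mx 0 i + p i = p i.+1.
  apply/rowP => j; rewrite !mxE !eqxx/= ltnS.
  have [->|] := eqVneq j i; first by rewrite ltnn leqnn mulr1 subrK.
  by move=> /negbTE ji; rewrite mulr0 add0r [(j <= i)%N]leq_eqVlt (inj_eq
    (@ord_inj n)) ji.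
rewrite scale0r add0r => ->; rewrite mulrC -/w -mulrBr normrM mulrC.
rewrite ler_wpM2r// distrC.
by have [] := dP _ (inb c cw) i.
Qed.

Lemma cvg_rV (T : Type) (F : set_system T) {FF : Filter F} (f : T ->
  'rV[R]_n) y :
  (forall i, (fun t => f t 0 i) @ F --> y 0 i) -> f @ F --> y.
Proof.
move=> fy; apply/cvg_ballP => e e0.
have : \forall t \near F, forall i, ball (y 0 i) e (f t 0 i).
  by apply: (filter_forall (F := F)) => i; have /cvg_ballP := fy i; exact.
by apply: filterS => t ft; split => // k j; rewrite ord1.
Qed.

End Frechet.

(* Partial derivatives on an open subset of R^n and derivatives within a subset of R
   are both limits of difference quotients; [dquot i x] is the filter of the pairs
   (y, h) where y tends to x in the direction i and h is the increment. *)
Record diff_space (R : realType) := DiffSpace {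
  dpoint :> Type;
  ddir : Type;
  dbase : set dpoint;
  dnear : dpoint -> set_system dpoint;
  dquot : ddir -> dpoint -> set_system (dpoint * R);
  dnear_filter : forall x, Filter (dnear x);
  dquot_proper : forall i x, dbase x -> ProperFilter (dquot i x);
  dquot_near : forall i x, dbase x -> fst @ dquot i x `=>` dnear x
}.

Section DiffSpace.
Context {R : realType} {E : diff_space R}.
Implicit Types (f g : E -> R) (x : E) (i : ddir E) (S : set E) (l m : R).

Definition diff_quot f x (z : E * R) : R := (f z.1 - f x) / z.2.

Definition is_pd i f x l := diff_quot f x @ dquot i x --> l.

Definition pd i f x : R := lim (diff_quot f x @ dquot i x).

Definition cont_at f x := f @ dnear x --> f x.

(** For curves this is openness relative to the domain, so that all of [a, b] qualifies. Membership
    in [dbase] makes the quotient filters proper, hence derivatives unique. *)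
Definition dopen S := forall x, S x -> dbase x /\ dnear x S.

Fixpoint Ck_on k S f : Prop :=
  (forall x, S x -> cont_at f x) /\
  if k is k'.+1 then
    forall i, (forall x, S x -> cvg (diff_quot f x @ dquot i x)) /\
      Ck_on k' S (pd i f)
  else True.

#[local] Existing Instance dnear_filter.

Lemma pdE i f x l : dbase x -> is_pd i f x l -> pd i f x = l.
Proof.
move=> Sx fl; have PF := dquot_proper i Sx.
by apply: cvg_lim => //; exact: norm_hausdorff.
Qed.

Lemma near_quot i x (A : set E) : dbase x -> dnear x A ->
  \forall z \near dquot i x, A z.1.
Proof. by move=> Sx; apply: dquot_near. Qed.

Lemma cont_quot i x f : dbase x -> cont_at f x ->
  (fun z : E * R => f z.1) @ dquot i x --> f x.
Proof. by move=> Sx fx A /fx; apply: dquot_near. Qed.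

Lemma is_pd_cst i x l : dbase x -> is_pd i (fun=> l) x 0.
Proof.
move=> Sx; have PF := dquot_proper i Sx.
rewrite /is_pd (_ : diff_quot _ _ = fun=> 0); first exact: cvg_cst.
by apply: funext => z; rewrite /diff_quot subrr mul0r.
Qed.

Lemma is_pdD i x f g l m : dbase x -> is_pd i f x l -> is_pd i g x m ->
  is_pd i (fun y => f y + g y) x (l + m).
Proof.
move=> Sx fl gm; have PF := dquot_proper i Sx.
rewrite /is_pd (_ : diff_quot _ _ = diff_quot f x \+ diff_quot g x).
  exact: cvgD.
by apply: funext => z; rewrite /diff_quot/= -mulrDl; congr (_ / _); ring.
Qed.

Lemma is_pdM i x f g l m : dbase x -> cont_at f x ->
  is_pd i f x l -> is_pd i g x m ->
  is_pd i (fun y => f y * g y) x (l * g x + f x * m).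
Proof.
move=> Sx cf fl gm; have PF := dquot_proper i Sx.
rewrite /is_pd (_ : diff_quot _ _ = fun z =>
    diff_quot f x z * g x + f z.1 * diff_quot g x z).
  apply: cvgD; first by apply: cvgM => //; exact: cvg_cst.
  by apply: cvgM => //; exact: cont_quot.
by apply: funext => z; rewrite /diff_quot/=; ring.
Qed.

Lemma near_is_pd i x f g l : dbase x -> f x = g x ->
  dnear x (fun y => f y = g y) -> is_pd i f x l -> is_pd i g x l.
Proof.
move=> Sx fgx fg; have PF := dquot_proper i Sx.
apply: cvg_trans; apply: near_eq_cvg; apply: filterS (near_quot i Sx fg) => z.
by rewrite /diff_quot fgx => ->.
Qed.

(** The first-order expansion of [phi] at [F x] leaves a remainder bounded by a small multiple of
    the sum of the absolute quotients of the coordinates of [F]; that sum converges, hence is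
    eventually bounded. *)
Lemma is_pd_comp n (phi : 'rV[R]_n -> R) i x (F : E -> 'rV[R]_n)
    (l : 'I_n -> R) : dbase x ->
  (forall j, \forall y \near F x, derivable phi y (delta_mx 0 j)) ->
  (forall j, {for F x, continuous (fun y => 'D_(delta_mx 0 j) phi y)}) ->
  (forall j, cont_at (fun y => F y 0 j) x) ->
  (forall j, is_pd i (fun y => F y 0 j) x (l j)) ->
  is_pd i (phi \o F) x (\sum_j 'D_(delta_mx 0 j) phi (F x) * l j).
Proof.
move=> Sx dphi cphi cF dF; have PF := dquot_proper i Sx.
pose r z := diff_quot (phi \o F) x z
  - \sum_j 'D_(delta_mx 0 j) phi (F x) * diff_quot (fun y => F y 0 j) x z.
rewrite /is_pd (_ : diff_quot _ _ = fun z =>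
    \sum_j 'D_(delta_mx 0 j) phi (F x) * diff_quot (fun y =>
      F y 0 j) x z + r z); last first.
  by apply: funext => z; rewrite /r addrCA subrr addr0.
rewrite -[X in _ --> X]addr0; apply: cvgD.
  by apply: (cvg_big (op := +%R)) => [|j _]; first (by move=> [u v];
    exact: add_continuous); apply: cvgM; [exact: cvg_cst|exact: dF].
(* One more than the limit of the sum of absolute quotients: an eventual bound for it that is
   positive even if all [l j] vanish. *)
pose M := \sum_j `|l j| + 1.
have M0 : 0 < M by rewrite ltr_wpDl// sumr_ge0.
have dFM : \forall z \near dquot i x,
    \sum_j `|diff_quot (fun y => F y 0 j) x z| <= M.
  have : (fun z => \sum_j `|diff_quot (fun y => F y 0 j) x z|) @ dquot i x
      --> \sum_j `|l j|.
    by apply: (cvg_big (op := +%R)) => [|j _]; first (by move=> [u v];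
      exact: add_continuous); apply: cvg_norm; exact: dF.
  by move=> /cvgr_le; apply; rewrite ltrDl.
apply/cvgr0Pnorm_le => e e0.
have FFx : F @ dnear x --> F x by apply: cvg_rV.
have /FFx/(near_quot i Sx) := C1_frechet dphi cphi (divr_gt0 e0 M0).
apply: filterS2 dFM => z zM /= zF.
rewrite /r /diff_quot/= [X in _ - X](_ : _ = (\sum_j (F z.1 0 j - F x 0 j) *
    'D_(delta_mx 0 j) phi (F x)) / z.2); last first.
  by rewrite mulr_suml; apply: eq_bigr => j _; rewrite mulrA [in RHS]mulrC;
    ring.
rewrite -mulrBl normrM; apply: (le_trans (ler_wpM2r _ zF)) => //.
rewrite -mulrA mulr_suml (eq_bigr (fun j => `|diff_quot (fun y =>
  F y 0 j) x z|)).
  by rewrite (le_trans (ler_wpM2l _ zM)) ?divfK ?gt_eqF// divr_ge0// ltW.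
by move=> j _; rewrite normrM.
Qed.

(* The derivatives [pd i f] do not depend on the set, which makes [Ck_on] local. *)
Lemma Ck_on_pointwise k S f :
  Ck_on k S f <-> forall x, S x -> Ck_on k [set x] f.
Proof.
elim: k f => [|k IH] f /=.
  split=> [[cf _] x Sx|cf]; first by split=> // _ ->; exact: cf.
  by split=> // x Sx; have [+ _] := cf x Sx; exact.
split=> [[cf df] x Sx|H].
  split=> [_ ->|i]; first exact: cf.
  have [di /IH pi] := df i; split; last exact: pi.
  by move=> _ ->; exact: di.
split=> [x Sx|i]; first by have [+ _] := H x Sx; exact.
split=> [x Sx|]; last by apply/IH => x Sx; have [_ /(_ i)[]] := H x Sx.
by have [_ /(_ i)[+ _]] := H x Sx; exact.
Qed.

Lemma Ck_on_local k S f :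
  (forall x, S x -> exists2 S', S' x & Ck_on k S' f) -> Ck_on k S f.
Proof.
move=> H; apply/Ck_on_pointwise => x Sx.
by have [S' S'x /Ck_on_pointwise] := H x Sx; exact.
Qed.

Lemma Ck_on_sub k S S' f : S' `<=` S -> Ck_on k S f -> Ck_on k S' f.
Proof.
by move=> sub /Ck_on_pointwise H; apply/Ck_on_pointwise => x /sub; exact: H.
Qed.

Lemma Ck_on_cont k S f x : Ck_on k S f -> S x -> cont_at f x.
Proof. by case: k => [|k] [cf _]; exact: cf. Qed.

Lemma Ck_onW k S f : Ck_on k.+1 S f -> Ck_on k S f.
Proof.
elim: k f => [|k IH] f [cf df]; split=> // i.
by have [? ?] := df i; split=> //; exact: IH.
Qed.

Lemma Ck_on_is_pd k S f i x : Ck_on k.+1 S f -> S x -> is_pd i f x (pd i f x).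
Proof. by move=> [_ /(_ i)[+ _]]; exact. Qed.

(** On an open set, equality at all points is equality near each point; so the derivatives agree on
    the set as well, and the induction goes on with them. *)
Lemma eq_Ck_on k S f g : dopen S -> (forall x, S x -> f x = g x) ->
  Ck_on k S f -> Ck_on k S g.
Proof.
move=> oS; elim: k f g => [|k IH] f g fg [cf df].
  split=> // x Sx; rewrite /cont_at -fg//.
  apply: cvg_trans (cf x Sx); apply: near_eq_cvg.
  by have [_] := oS x Sx; apply: filterS => y; exact: fg.
have pdfg i x : S x -> is_pd i f x (pd i f x) -> is_pd i g x (pd i f x).
  move=> Sx; have [bx Nx] := oS x Sx.
  by apply: near_is_pd => //; [exact: fg|exact: filterS Nx].
split=> [x Sx|i].
  by apply: Ck_on_cont Sx; apply: IH fg _; apply: Ck_onW; split.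
have [di pi] := df i; split=> [x Sx|].
  by apply: cvgP (pdfg i x Sx (di x Sx)).
apply: IH pi => x Sx; apply/esym/pdE; first by have [] := oS x Sx.
exact/pdfg/di.
Qed.

(** Off [S] the limit [pd i f] may be a default value; it is enough to exhibit a derivative that is
    correct on [S]. *)
Lemma Ck_on_cons k S f : dopen S -> (forall x, S x -> cont_at f x) ->
  (forall i, exists2 f', (forall x, S x ->
    is_pd i f x (f' x)) & Ck_on k S f') ->
  Ck_on k.+1 S f.
Proof.
move=> oS cf H; split=> // i; have [f' df f'k] := H i.
split=> [x /df|]; first exact: cvgP.
apply: (eq_Ck_on oS) f'k => x Sx; apply/esym/pdE/df => //.
by have [] := oS x Sx.
Qed.

Lemma Ck_on_cst k S l : dopen S -> Ck_on k S (fun=> l).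
Proof.
move=> oS; elim: k l => [|k IH] l; first by split=> // x _; exact: cvg_cst.
apply: Ck_on_cons => // [x _|i]; first exact: cvg_cst.
by exists (fun=> 0) => // x Sx; apply: is_pd_cst; have [] := oS x Sx.
Qed.

Lemma Ck_onD k S f g : dopen S -> Ck_on k S f -> Ck_on k S g ->
  Ck_on k S (fun x => f x + g x).
Proof.
move=> oS; elim: k f g => [|k IH] f g fk gk.
  by split=> // x Sx; apply: cvgD; [exact: Ck_on_cont fk Sx|exact: Ck_on_cont
    gk Sx].
apply: Ck_on_cons => // [x Sx|i].
  by apply: cvgD; [exact: Ck_on_cont fk Sx|exact: Ck_on_cont gk Sx].
exists (fun x => pd i f x + pd i g x) => [x Sx|].
  apply: is_pdD; [by have [] := oS x Sx|exact: Ck_on_is_pd fk Sx|].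
  exact: Ck_on_is_pd gk Sx.
by apply: IH; [have [_ /(_ i)[]] := fk|have [_ /(_ i)[]] := gk].
Qed.

Lemma Ck_onM k S f g : dopen S -> Ck_on k S f -> Ck_on k S g ->
  Ck_on k S (fun x => f x * g x).
Proof.
move=> oS; elim: k f g => [|k IH] f g fk gk.
  by split=> // x Sx; apply: cvgM; [exact: Ck_on_cont fk Sx|exact: Ck_on_cont
    gk Sx].
apply: Ck_on_cons => // [x Sx|i].
  by apply: cvgM; [exact: Ck_on_cont fk Sx|exact: Ck_on_cont gk Sx].
exists (fun x => pd i f x * g x + f x * pd i g x) => [x Sx|].
  apply: is_pdM; [by have [] := oS x Sx|exact: Ck_on_cont fk Sx| |].
    exact: Ck_on_is_pd fk Sx.
  exact: Ck_on_is_pd gk Sx.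
have [_ /(_ i)[_ fk']] := fk; have [_ /(_ i)[_ gk']] := gk.
by apply: Ck_onD => //; apply: IH => //; exact: Ck_onW.
Qed.

Lemma Ck_on_sum k S (J : Type) (r : seq J) (P : pred J) (f : J -> E -> R) :
  dopen S -> (forall j, Ck_on k S (f j)) ->
  Ck_on k S (fun x => \sum_(j <- r | P j) f j x).
Proof.
move=> oS fk; elim: r => [|j r IH].
  rewrite (_ : (fun x => _) = fun=> 0); first exact: Ck_on_cst.
  by apply: funext => x; rewrite big_nil.
have [Pj|Pj] := boolP (P j); last first.
  rewrite (_ : (fun x => _) = fun x => \sum_(j <- r | P j) f j x)//.
  by apply: funext => x; rewrite big_cons (negbTE Pj).
rewrite (_ : (fun x => _) = fun x => f j x + \sum_(j <- r | P j) f j x).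
  exact: Ck_onD.
by apply: funext => x; rewrite big_cons Pj.
Qed.

(** By the chain rule a derivative of the composite is a sum of products of a partial derivative of
    [phi] composed with [F], covered by the induction hypothesis, and a derivative of a coordinate
    of [F]. *)
Lemma Ck_on_comp n k S (U : set 'rV[R]_n) (phi : 'rV[R]_n -> R)
    (F : E -> 'rV[R]_n) :
  dopen S -> open U -> (forall x, S x -> U (F x)) -> Ck k U phi ->
  (forall j, Ck_on k S (fun x => F x 0 j)) -> Ck_on k S (phi \o F).
Proof.
move=> oS oU SU; elim: k phi => [|k IH] phi phik Fk.
  split=> // x Sx; have FFx : F @ dnear x --> F x.
    by apply: cvg_rV => j; exact: Ck_on_cont (Fk j) Sx.
  have c : phi @ nbhs (F x) --> phi (F x).
    by have [+ _] := phik; apply; exact: SU.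
  exact: cvg_comp FFx c.
apply: Ck_on_cons => // [x Sx|i].
  have FFx : F @ dnear x --> F x.
    by apply: cvg_rV => j; exact: Ck_on_cont (Fk j) Sx.
  have c : phi @ nbhs (F x) --> phi (F x).
    by have [+ _] := phik; apply; exact: SU.
  exact: cvg_comp FFx c.
exists (fun x => \sum_j 'D_(delta_mx 0 j) phi (F x)
                   * pd i (fun x => F x 0 j) x) => [x Sx|].
  apply: is_pd_comp => [|j|j|j|j].
  - by have [] := oS x Sx.
  - have [_ /(_ j)[dphi _]] := phik.
    by apply: filterS (open_nbhs_nbhs (conj oU (SU x Sx))) => y; exact: dphi.
  - by have [_ /(_ j)[_]] := phik; by case: k {IH phik Fk} => [|k] [+ _];
    apply; exact: SU.
  - exact: Ck_on_cont (Fk j) Sx.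
  - exact: Ck_on_is_pd (Fk j) Sx.
apply: Ck_on_sum => // j; apply: Ck_onM => //;
  last by have [_ /(_ i)[]] := Fk j.
apply: (IH (fun y => 'D_(delta_mx 0 j) phi y)) => [|j']; last exact: Ck_onW.
by have [_ /(_ j)[]] := phik.
Qed.

End DiffSpace.

(** * The two instances: open sets of row vectors and subsets of the line *)

Section RowSpace.
Context {R : realType} {n : nat}.
Implicit Types (x : 'rV[R]_n) (f : 'rV[R]_n -> R) (U : set 'rV[R]_n).

Definition rV_quot (i : 'I_n) x : set_system ('rV[R]_n * R) :=
  (fun h : R => (h *: delta_mx 0 i + x, h)) @ 0^'.

Fact rV_quot_near i x : True -> fst @ rV_quot i x `=>` nbhs x.
Proof.
move=> _; have c : (fun h : R => h *: delta_mx 0 i + x) @ 0^' --> x.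
  apply: cvg_rV => j; rewrite (_ : (fun h => _) = fun h : R =>
    h * (delta_mx 0 i : 'rV[R]_n) 0 j + x 0 j); last first.
    by apply: funext => h; rewrite !mxE.
  rewrite -[X in _ --> X]add0r; apply: cvgD; last exact: cvg_cst.
  rewrite -[X in _ --> X](mul0r ((delta_mx 0 i : 'rV[R]_n) 0 j)).
  apply: (@cvgM _ _ 0^' _ id) => /=; [exact: cvg_within|exact: cvg_cst].
exact: c.
Qed.

Definition rV_space : diff_space R :=
  @DiffSpace R 'rV[R]_n 'I_n setT nbhs rV_quot (fun x => nbhs_filter x)
    (fun i x _ => fmap_proper_filter _ _) rV_quot_near.

Lemma open_dopen U : open U -> dopen (E := rV_space) U.
Proof. by move=> oU x Ux; split => //; apply: open_nbhs_nbhs. Qed.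

Lemma rV_diff_quot f i x : diff_quot (E := rV_space) f x @ rV_quot i x =
  (fun h : R => h^-1 *: ((f \o shift x) (h *: delta_mx 0 i) - f x)) @ 0^'.
Proof.
apply: (congr1 (fun g => g @ 0^')); apply: funext => h.
by rewrite /diff_quot/= mulrC.
Qed.

Lemma rV_pdE f i x : pd (E := rV_space) i f x = 'D_(delta_mx 0 i) f x.
Proof. by rewrite /pd/= rV_diff_quot. Qed.

Lemma Ck_on_rV k U f : Ck_on (E := rV_space) k U f <-> Ck k U f.
Proof.
elim: k f => [|k IH] f /=; first by [].
split=> -[cf df]; split=> // i; have [di pi] := df i; split.
- by move=> x /di/=; rewrite rV_diff_quot.
- by apply/IH; rewrite (_ : (fun x => _) = pd (E := rV_space) i f)//;
  apply: funext => x; rewrite rV_pdE.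
- by move=> x /di; rewrite rV_diff_quot.
- by move/IH: pi; rewrite (_ : (fun x => _) = pd (E := rV_space) i f)//;
  apply: funext => x; rewrite rV_pdE.
Qed.

Lemma is_pd_coord i j x :
  is_pd (E := rV_space) i (fun x => x 0 j) x (i == j)%:R.
Proof.
have PF : ProperFilter (rV_quot i x) by apply: fmap_proper_filter.
apply: (@cvg_trans _ ((fun=> (i == j)%:R : R) @ rV_quot i x));
  last exact: cvg_cst.
apply: near_eq_cvg; rewrite /rV_quot near_simpl; near=> h.
rewrite /diff_quot/= !mxE eqxx/= eq_sym addrK mulrC mulKf//.
by near: h; exact: nbhs_dnbhs_neq.
Unshelve. all: by end_near. Qed.

Lemma Ck_on_coord k U j : open U -> Ck_on (E := rV_space) k U (fun x => x 0 j).
Proof.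
move=> oU; have c x : cont_at (E := rV_space) (fun x => x 0 j) x.
  exact: coord_continuous.
case: k => [|k]; first by split.
apply: Ck_on_cons => [|x _|i]; [exact: open_dopen|exact: c|].
exists (fun=> (i == j)%:R) => [x _|]; last exact/Ck_on_cst/open_dopen.
exact: is_pd_coord.
Qed.

End RowSpace.

Arguments rV_space R n : clear implicits.

Section Within.
Context {R : realType} (D : set R).

(** No isolated points: exactly what makes the punctured filters proper and a derivative within [D]
    unique. *)
Definition dense_in_itself := forall t, D t ->
  ProperFilter (within (D `\ t) (nbhs t)).

Definition within_quot (_ : unit) (t : R) : set_system (R * R) :=
  (fun s => (s, s - t)) @ within (D `\ t) (nbhs t).

Fact within_quot_near i t : D t ->
  fst @ within_quot i t `=>` within D (nbhs t).
Proof.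
move=> _ A; change (nbhs t (fun s => D s -> A s) ->
  nbhs t (fun s => (D `\ t) s -> A s)).
by apply: filterS => s As [] /As.
Qed.

Definition within_space (pD : dense_in_itself) : diff_space R :=
  @DiffSpace R R unit D (fun t => within D (nbhs t)) within_quot
    (fun t => within_filter _ _)
    (fun _ t Dt => @fmap_proper_filter _ _ _ _ (pD t Dt)) within_quot_near.

Variable pD : dense_in_itself.
Local Notation E := (within_space pD).
Implicit Types (S : set R) (f : R -> R) (t : R).

Lemma dopenT : dopen (E := E) D.
Proof. by move=> t Dt; split=> //=; exact: withinT. Qed.

(** [Ck_curve] differentiates within the part of [D] sent into a chart, a set that varies with the
    chart. Relative openness gives it the same neighbourhood filter as [D], so all these derivatives
    are derivatives within [D]. *)
Lemma within_dopen S t : dopen (E := E) S -> S t ->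
  within S (nbhs t) = within D (nbhs t).
Proof.
move=> oS St; have [_ NS] := oS t St.
have {}NS : nbhs t (fun s => D s -> S s) := NS.
apply/seteqP; split=> A.
  change (nbhs t (fun s => S s -> A s) -> nbhs t (fun s => D s -> A s)).
  by move: NS; apply: filterS2 => s NS SA /NS.
change (nbhs t (fun s => D s -> A s) -> nbhs t (fun s => S s -> A s)).
by apply: filterS => s DA /oS[Ds _]; exact: DA.
Qed.

Lemma within_dopenD1 S t : dopen (E := E) S -> S t ->
  within (S `\ t) (nbhs t) = within (D `\ t) (nbhs t).
Proof.
move=> oS St; have [_ NS] := oS t St.
have {}NS : nbhs t (fun s => D s -> S s) := NS.
apply/seteqP; split=> A.
  change (nbhs t (fun s => (S `\ t) s -> A s) ->
    nbhs t (fun s => (D `\ t) s -> A s)).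
  by move: NS; apply: filterS2 => s NS SA [/NS Ss st]; apply: SA.
change (nbhs t (fun s => (D `\ t) s -> A s) ->
  nbhs t (fun s => (S `\ t) s -> A s)).
by apply: filterS => s DA [/oS[Ds _] st]; exact: DA.
Qed.

Lemma within_pdE S f t : dopen (E := E) S -> S t ->
  derive_within S f t = pd (E := E) tt f t.
Proof. by move=> oS St; rewrite /derive_within within_dopenD1. Qed.

Lemma within_continuousP (T : topologicalType) S (g : R -> T) :
  dopen (E := E) S ->
  {within S, continuous g} <-> forall t, S t -> g @ within D (nbhs t) --> g t.
Proof.
move=> oS; rewrite subspace_continuousP.
by split=> H t St; have := H t St; rewrite within_dopen.
Qed.

Lemma Ck_on_within k S f : dopen (E := E) S ->
  Ck_on (E := E) k S f <-> Ck_within k S f.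
Proof.
move=> oS; elim: k f => [|k IH] f /=; first by rewrite within_continuousP.
rewrite within_continuousP//; split=> -[cf df]; split=> //.
  have [di pi] := df tt; split=> [t St|].
    by rewrite /derivable_within within_dopenD1//; exact: di.
  by apply/IH; apply: eq_Ck_on pi => // t St; rewrite within_pdE.
case; have [di pi] := df; split=> [t St|].
  by have := di t St; rewrite /derivable_within within_dopenD1.
by move/IH: pi; apply: eq_Ck_on => // t St; rewrite within_pdE.
Qed.

Lemma is_pd_id t : D t -> is_pd (E := E) tt id t 1.
Proof.
move=> Dt; apply: (@cvg_trans _ ((fun=> 1 : R) @ within_quot tt t)); last first.
  by have PF' := dquot_proper (d := E) tt Dt; exact: cvg_cst.
apply: near_eq_cvg; change (nbhs t (fun s => (D `\ t) s ->
  1 = diff_quot (E := E) id t (s, s - t))); apply: filterE => s [_ st].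
by rewrite /diff_quot/= divff// subr_eq0; apply/eqP.
Qed.

Lemma Ck_on_id k S : dopen (E := E) S -> Ck_on (E := E) k S id.
Proof.
move=> oS; have c t : cont_at (E := E) id t by apply: cvg_within.
case: k => [|k]; first by split.
apply: Ck_on_cons => // -[]; exists (fun=> 1) => [t St|]; last exact: Ck_on_cst.
by apply: is_pd_id; have [] := oS t St.
Qed.

End Within.

Lemma dopen_preimage (R : realType) (D : set R) (pD : dense_in_itself D)
    (T : topologicalType) (g : R -> T) (U : set T) :
  {within D, continuous g} -> open U ->
  dopen (E := within_space pD) (D `&` g @^-1` U).
Proof.
move=> /(within_continuousP _ (@dopenT _ _ pD)) cg oU t [Dt Ut]; split=> //=.
have NU : nbhs (g t) U by exact: open_nbhs_nbhs.
have gNU : nbhs t (fun s => D s -> U (g s)) := cg t Dt _ NU.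
change (nbhs t (fun s => D s -> (D `&` g @^-1` U) s)).
by apply: filterS gNU => s gU Ds; split=> //; exact: gU.
Qed.

Lemma open_dense_in_itself (R : realType) (D : set R) : open D ->
  dense_in_itself D.
Proof.
move=> oD t Dt; apply: Build_ProperFilter_ex => A.
have : nbhs t D by exact: open_nbhs_nbhs.
move=> ND NA; have {NA}NA : nbhs t (fun s => (D `\ t) s -> A s) := NA.
have /nbhs_ballP[e e0 eA] : nbhs t (D `&` (fun s => (D `\ t) s -> A s)).
  exact: filterI.
exists (t + e / 2).
have [] := eA (t + e / 2) _.
  rewrite /ball/= opprD addrA subrr sub0r normrN gtr0_norm ?divr_gt0//.
  by rewrite gtr_pMr// invf_lt1// ltr1n.
move=> Ds; apply; split=> //= /eqP.
by rewrite -subr_eq0 addrAC subrr add0r gt_eqF// divr_gt0.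
Qed.

Lemma segment_dense_in_itself (R : realType) (a b : R) : a < b ->
  dense_in_itself `[a, b].
Proof.
move=> ab t; rewrite /= in_itv/= => /andP[at_ tb].
apply: Build_ProperFilter_ex => A /nbhs_ballP[e /= e0 eA].
(* A second point of the segment is found to the right of [t], or to the left when [t] is the right
   end; the minimum and maximum keep it in [a, b]. *)
have [tlb|tb'] := ltP t b.
  exists (Num.min b (t + e / 2)); apply: eA => /=.
    rewrite /ball/= ltr_norml; case: (leP b (t + e / 2)) => ?; lra.
  split; first by rewrite /= in_itv/=; case: (leP b (t + e / 2)) => ?; lra.
  by move=> /= E; move: E; case: (leP b (t + e / 2)) => ? E; lra.
exists (Num.max a (t - e / 2)); apply: eA => /=.
  rewrite /ball/= ltr_norml; case: (leP a (t - e / 2)) => ?; lra.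
split; first by rewrite /= in_itv/=; case: (leP a (t - e / 2)) => ?; lra.
by move=> /= E; move: E; case: (leP a (t - e / 2)) => ? E; lra.
Qed.

(** * Manifolds and tangent vectors *)

Section Charts.
Context {R : realType} {n : nat} {M : smoothManifoldType R n}.
Implicit Types (U : set M) (f : M -> R) (p : M) (c d : chart R n M).

Definition chart_set c U : set 'rV[R]_n :=
  [set x | chart_img c x /\ U (chart_inv c x)].

Lemma chart_set_open c U : open U -> open (chart_set c U).
Proof.
move=> oU; rewrite openE => x [cx Ux].
have Nc : nbhs x (chart_img c).
  by apply: open_nbhs_nbhs; split=> //; exact: chart_img_open.
have NU : nbhs x (fun y => U (chart_inv c y)).
  by apply: (chart_inv_continuous cx); exact: open_nbhs_nbhs.
exact: filterI Nc NU.
Qed.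

Lemma smooth_onP U f : smooth_on U f <-> forall c k, atlas c ->
  Ck_on (E := rV_space R n) k (chart_set c U) (f \o chart_inv c).
Proof.
split=> [H c k /H /(_ k)/Ck_on_rV|H c ac k]; first by [].
by apply/Ck_on_rV; exact: H.
Qed.

Lemma smooth_on_sub U U' f : U' `<=` U -> smooth_on U f -> smooth_on U' f.
Proof.
move=> sub /smooth_onP H; apply/smooth_onP => c k ac.
by apply: Ck_on_sub (H c k ac) => x [? /sub].
Qed.

Lemma smooth_on_coord c i : atlas c ->
  smooth_on (chart_dom c) (fun p => chart_map c p 0 i).
Proof. by move=> ac d ad; exact: atlas_compat. Qed.

Lemma smooth_near_coord c i p : atlas c -> chart_dom c p ->
  smooth_near p (fun p => chart_map c p 0 i).
Proof.
move=> ac cp; exists (chart_dom c); split=> //; first exact: chart_dom_open.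
exact: smooth_on_coord.
Qed.

Lemma smooth_on_cst U (r : R) : open U -> smooth_on U (fun=> r).
Proof.
move=> oU; apply/smooth_onP => c k ac; apply: Ck_on_cst.
exact/open_dopen/chart_set_open.
Qed.

Lemma smooth_onD U f g : open U -> smooth_on U f -> smooth_on U g ->
  smooth_on U (fun p => f p + g p).
Proof.
move=> oU /smooth_onP fU /smooth_onP gU; apply/smooth_onP => c k ac.
by apply: Ck_onD; [exact/open_dopen/chart_set_open|exact: fU|exact: gU].
Qed.

Lemma smooth_onM U f g : open U -> smooth_on U f -> smooth_on U g ->
  smooth_on U (fun p => f p * g p).
Proof.
move=> oU /smooth_onP fU /smooth_onP gU; apply/smooth_onP => c k ac.
by apply: Ck_onM; [exact/open_dopen/chart_set_open|exact: fU|exact: gU].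
Qed.

Lemma smooth_on_sum U (J : Type) (r : seq J) (P : pred J) (f : J -> M -> R) :
  open U -> (forall j, smooth_on U (f j)) ->
  smooth_on U (fun p => \sum_(j <- r | P j) f j p).
Proof.
move=> oU fU; apply/smooth_onP => c k ac; apply: Ck_on_sum.
  exact/open_dopen/chart_set_open.
by move=> j; have /smooth_onP := fU j; exact.
Qed.

End Charts.

(** * Smooth maps from a difference-quotient space to a manifold *)

Section SmoothMap.
Context {R : realType} {E : diff_space R} {n : nat} {M :
  smoothManifoldType R n}.
Implicit Types (S : set E) (F : E -> M) (c : chart R n M).

(** The source is an arbitrary [diff_space], so that curves on [a, b] and maps given in charts or
    product charts obey the same lemmas. *)
Definition smooth_map S F :=
  (forall x, S x -> F @ dnear x --> F x) /\
  forall c, atlas c -> forall i k,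
    Ck_on k (S `&` F @^-1` chart_dom c) (fun x => chart_map c (F x) 0 i).

Lemma dopen_smooth_preimage S F (U : set M) : dopen S ->
  (forall x, S x -> F @ dnear x --> F x) -> open U -> dopen (S `&` F @^-1` U).
Proof.
move=> oS cF oU x [Sx Ux]; have [bx Nx] := oS x Sx; split=> //.
have NF := dnear_filter x; apply: filterI => //.
by apply: (cF x Sx); apply: open_nbhs_nbhs.
Qed.

Lemma smooth_map_comp S F (U : set M) (f : M -> R) k :
  dopen S -> open U -> smooth_map S F -> (forall x, S x -> U (F x)) ->
  smooth_on U f -> Ck_on k S (f \o F).
Proof.
move=> oS oU [cF sF] SU fU; apply: Ck_on_local => x Sx.
have [c ac cFx] := atlas_cover (F x).
have oS' : dopen (S `&` F @^-1` chart_dom c).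
  by apply: dopen_smooth_preimage => //; exact: chart_dom_open.
exists (S `&` F @^-1` chart_dom c) => //.
apply: (@eq_Ck_on _ _ _ _ ((f \o chart_inv c) \o (chart_map c \o F))) => //.
  by move=> y [Sy cy] /=; rewrite chart_mapK.
apply: (@Ck_on_comp _ _ _ _ _ (chart_set c U)) => //.
- exact: chart_set_open.
- move=> y [Sy cy]; split; first exact: chart_map_img.
  by rewrite /= chart_mapK//; exact: SU.
- exact: fU.
- by move=> j; exact: sF.
Qed.

(** A single chart around each image point suffices, since any other chart differs from it by a
    smooth transition map. *)
Lemma smooth_map_of S F :
  (forall x, S x -> F @ dnear x --> F x) ->
  (forall x, S x -> exists c S', [/\ atlas c, S' x, dopen S',
     forall y, S' y -> chart_dom c (F y) &
     forall i k, Ck_on k S' (fun y => chart_map c (F y) 0 i)]) ->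
  smooth_map S F.
Proof.
move=> cF H; split=> // d ad i k; apply: Ck_on_local => x [Sx dFx].
have [c [S' [ac S'x oS' S'c S'k]]] := H x Sx.
have NF := dnear_filter x.
have oT : open (chart_set c (chart_dom d)).
  exact/chart_set_open/chart_dom_open.
have oS'' : dopen (S' `&` (chart_map c \o F) @^-1` chart_set c (chart_dom d)).
  move=> y [S'y [_ /=]]; rewrite chart_mapK; last exact: S'c; move=> dy.
  have [bx Ny] := oS' y S'y; split=> //.
  have NFy := dnear_filter y; apply: filterI => //.
  have cc : (chart_map c \o F) @ dnear y --> (chart_map c \o F) y.
    by apply: cvg_rV => j; exact: Ck_on_cont (S'k j 0%N) S'y.
  apply: cc; apply: open_nbhs_nbhs; split=> //.
  by split; [apply: chart_map_img; exact: S'c|rewrite /= chart_mapK;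
    [|exact: S'c]].
exists (S' `&` (chart_map c \o F) @^-1` chart_set c (chart_dom d)).
  by split=> //; split; [apply: chart_map_img;
    exact: S'c|rewrite /= chart_mapK; [|exact: S'c]].
apply: (@eq_Ck_on _ _ _ _ ((fun z => chart_map d (chart_inv c z) 0 i) \o
    (chart_map c \o F))) => //.
  by move=> y [S'y _] /=; rewrite chart_mapK; [|exact: S'c].
apply: (@Ck_on_comp _ _ _ _ _ (chart_set c (chart_dom d))) => //.
- by move=> y [].
- exact: atlas_compat.
- by move=> j; apply: Ck_on_sub (S'k j k) => y [].
Qed.

Lemma smooth_map_sub S S' F : S' `<=` S -> smooth_map S F -> smooth_map S' F.
Proof.
move=> sub [cF sF]; split=> [x /sub|c ac i k]; first exact: cF.
by apply: Ck_on_sub (sF c ac i k) => x [/sub].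
Qed.

Lemma smooth_map_cst S (p : M) : dopen S -> smooth_map S (fun=> p).
Proof.
move=> oS; have [c ac cp] := atlas_cover p.
apply: smooth_map_of => x Sx; first by have NF := dnear_filter x;
  exact: cvg_cst.
by exists c, S; split=> // i k; exact: Ck_on_cst.
Qed.

Lemma smooth_map_chart_inv S c (A : E -> 'rV[R]_n) : atlas c -> dopen S ->
  (forall x, S x -> chart_img c (A x)) ->
  (forall i k, Ck_on k S (fun x => A x 0 i)) ->
  smooth_map S (chart_inv c \o A).
Proof.
move=> ac oS Sc Ak; apply: smooth_map_of => x Sx.
  have NF := dnear_filter x.
  have cA : A @ dnear x --> A x.
    by apply: cvg_rV => j; exact: Ck_on_cont (Ak j 0%N) Sx.
  have cc : chart_inv c @ nbhs (A x) --> chart_inv c (A x).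
    exact: chart_inv_continuous (Sc x Sx).
  exact: cvg_comp cA cc.
exists c, S; split=> // [y Sy|i k]; first exact/chart_inv_dom/Sc.
by apply: eq_Ck_on (Ak i k) => // y Sy /=; rewrite chart_invK//; exact: Sc.
Qed.

Lemma smooth_map_is_pd S F c (f : M -> R) i x : dopen S -> smooth_map S F ->
  S x -> atlas c -> chart_dom c (F x) -> smooth_near (F x) f ->
  is_pd i (f \o F) x
    (\sum_j 'D_(delta_mx 0 j) (f \o chart_inv c) (chart_map c (F x))
       * pd i (fun y => chart_map c (F y) 0 j) x).
Proof.
move=> oS [cF sF] Sx ac cFx [U [oU Ux /(_ c ac) fU]].
have [bx Nx] := oS x Sx; have NF := dnear_filter x.
apply: (@near_is_pd _ _ _ _ ((f \o chart_inv c) \o (chart_map c \o F))) => //=.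
- by rewrite chart_mapK.
- have : dnear x (F @^-1` chart_dom c).
    by apply: (cF x Sx); apply: open_nbhs_nbhs; split=> //;
      exact: chart_dom_open.
  by apply: filterS => y cy; rewrite chart_mapK.
have Ux' : chart_set c U (chart_map c (F x)).
  by split; [exact: chart_map_img|rewrite /= chart_mapK].
apply: is_pd_comp => // j.
- have [_ /(_ j)[dphi _]] := fU 1%N.
  have oU' := chart_set_open (c := c) oU.
  by apply: filterS (open_nbhs_nbhs (conj oU' Ux')) => y; exact: dphi.
- by have [_ /(_ j)[_ [+ _]]] := fU 1%N; apply.
- by apply: Ck_on_cont (sF c ac j 0%N) _.
- by apply: Ck_on_is_pd (sF c ac j 1%N) _.
Qed.

End SmoothMap.

Lemma smooth_curveP (R : realType) (n : nat) (M : smoothManifoldType R n)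
    (D : set R) (pD : dense_in_itself D) (g : R -> M) :
  smooth_curve D g <-> smooth_map (E := within_space pD) D g.
Proof.
have oD := @dopenT _ _ pD.
split=> [H|[cg sg] k].
  split; first by apply/(within_continuousP g oD); have [] := H 0%N.
  move=> c ac i k; have [cg sg] := H k; apply/Ck_on_within; last exact: sg.
  by apply: dopen_preimage => //; exact: chart_dom_open.
have cg' : {within D, continuous g} by apply/(within_continuousP g oD).
split=> // c ac i; apply/(@Ck_on_within _ _ pD); last exact: sg.
by apply: dopen_preimage => //; exact: chart_dom_open.
Qed.

(** * Tangent vectors in coordinates *)

Section TangentVectors.
Context {R : realType} {n : nat} {M : smoothManifoldType R n}.
Implicit Types (p : M) (c : chart R n M) (f : M -> R) (u v : tvec R M).

(** The vector with components [w] in the coordinate frame at [p]. Truncation by [on_germs] makes it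
    equal, as a functional on all functions, to the velocity of a curve. *)
Definition chart_vec c p (w : 'rV[R]_n) : tvec R M := on_germs p (fun f =>
  \sum_j w 0 j * 'D_(delta_mx 0 j) (f \o chart_inv c) (chart_map c p)).

Lemma velocityE (D : set R) (g : R -> M) t c : dense_in_itself D ->
  smooth_curve D g -> D t -> atlas c -> chart_dom c (g t) ->
  velocity D g t = chart_vec c (g t)
    (\row_j derive_within D (fun s => chart_map c (g s) 0 j) t).
Proof.
move=> pD gD Dt ac ct; have oD := @dopenT _ _ pD.
have /smooth_curveP sg := gD.
apply: funext => f; rewrite /velocity /chart_vec /on_germs.
case: asboolP => // sf; rewrite (within_pdE _ oD)//.
rewrite (pdE _ (smooth_map_is_pd (E := within_space pD) (i :=
  tt) oD (sg pD) Dt ac ct sf))//.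
by apply: eq_bigr => j _; rewrite mxE (within_pdE _ oD)// mulrC.
Qed.

(** The curve is the straight line through the image of [p] with direction [w], for times short
    enough to stay in the chart. *)
Lemma chart_vec_tangent c p w : atlas c -> chart_dom c p ->
  tangent p (chart_vec c p w).
Proof.
move=> ac cp; pose A (s : R) := s *: w + chart_map c p.
have cA : A @ (0 : R) --> chart_map c p.
  apply: cvg_rV => j; rewrite (_ : (fun s => _) =
    fun s : R => s * w 0 j + chart_map c p 0 j); last first.
    by apply: funext => s; rewrite !mxE.
  rewrite -[X in _ --> X]add0r; apply: cvgD; last exact: cvg_cst.
  rewrite -[X in _ --> X](mul0r (w 0 j)).
  by apply: (@cvgM _ _ (nbhs (0 : R)) _ id) => //; exact: cvg_cst.
have : nbhs (chart_map c p) (chart_img c).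
  apply: open_nbhs_nbhs; split; [exact: chart_img_open|exact: chart_map_img].
move=> /cA/nbhs_ballP[e /= e0 eA].
pose D : set R := `]- e, e[%classic.
have D0 : D 0 by rewrite /D /= in_itv/=; lra.
have DA s : D s -> chart_img c (A s).
  by rewrite /D /= in_itv/= => es; apply: eA; rewrite /ball/= ltr_norml; lra.
have pD : dense_in_itself D by apply: open_dense_in_itself;
  exact: interval_open.
have oD := @dopenT _ _ pD.
have A0 : chart_inv c (A 0) = p by rewrite /A scale0r add0r chart_mapK.
have AE j : (fun s => A s 0 j) = fun s => s * w 0 j + chart_map c p 0 j.
  by apply: funext => s; rewrite !mxE.
have sA : smooth_map (E := within_space pD) D (chart_inv c \o A).
  apply: smooth_map_chart_inv => // j k; rewrite AE.
  apply: Ck_onD => //; last exact: Ck_on_cst.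
  by apply: Ck_onM => //; [exact: Ck_on_id|exact: Ck_on_cst].
have sc : smooth_curve D (chart_inv c \o A) by apply/smooth_curveP.
exists e, (chart_inv c \o A); split=> //.
rewrite (velocityE pD sc D0 ac) -?[(_ \o _) 0]/(chart_inv c (A 0)) A0//.
congr (chart_vec _ _ _); apply/rowP => j; rewrite mxE (within_pdE _ oD)//.
apply/esym/pdE => //.
apply: (@near_is_pd _ (within_space pD) _ _ (fun s =>
  s * w 0 j + chart_map c p 0 j)) => //=.
- by rewrite A0 mul0r add0r.
- change (nbhs (0 : R) (fun s => D s -> s * w 0 j + chart_map c p 0 j =
    chart_map c (chart_inv c (A s)) 0 j)).
  by apply: filterE => s Ds; rewrite (chart_invK (DA s Ds)) !mxE.
- rewrite -[X in is_pd _ _ _ X]addr0; apply: is_pdD => //;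
  last exact: is_pd_cst.
  rewrite -[X in is_pd _ _ _ X](_ : 1 * w 0 j + 0 * 0 = w 0 j); last by ring.
  apply: (@is_pdM _ (within_space pD)) => //; first by apply: cvg_within.
    exact: is_pd_id.
  exact: is_pd_cst.
Qed.

(** With [chart_vec_tangent] this identifies the classes of curves with the row vectors, which is
    why sums and multiples of velocities, taken as functionals, are again velocities. *)
Lemma tangent_chart_vec c p u : atlas c -> chart_dom c p -> tangent p u ->
  exists w, u = chart_vec c p w.
Proof.
move=> ac cp [e [g [e0 sg gp ->]]].
have pD : dense_in_itself (`]- e, e[%classic : set R).
  by apply: open_dense_in_itself; exact: interval_open.
rewrite (velocityE pD sg _ ac) ?gp//; first by eexists.
by rewrite /= in_itv/=; lra.
Qed.

Lemma derive_chart_coord c p i j : chart_dom c p ->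
  'D_(delta_mx 0 j) ((fun q => chart_map c q 0 i) \o chart_inv c)
    (chart_map c p) = (j == i)%:R.
Proof.
move=> cp; rewrite -rV_pdE; apply: pdE => //.
apply: (@near_is_pd _ (rV_space R n) _ _ (fun x => x 0 i)) => //=.
- by rewrite chart_mapK.
- have : nbhs (chart_map c p) (chart_img c).
    apply: open_nbhs_nbhs; split; [exact: chart_img_open|exact: chart_map_img].
  by apply: filterS => y cy; rewrite chart_invK.
- exact: is_pd_coord.
Qed.

Lemma chart_vec_coord c p w i : atlas c -> chart_dom c p ->
  chart_vec c p w (fun q => chart_map c q 0 i) = w 0 i.
Proof.
move=> ac cp; rewrite /chart_vec /on_germs; case: asboolP => [_|].
  rewrite (bigD1 i)//= derive_chart_coord// eqxx mulr1 big1 ?addr0// => j ji.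
  by rewrite derive_chart_coord// (negbTE ji) mulr0.
by case; exact: smooth_near_coord.
Qed.

Lemma chart_vecD c p w1 w2 :
  chart_vec c p (w1 + w2) = chart_vec c p w1 + chart_vec c p w2.
Proof.
apply: funext => f.
change (chart_vec c p (w1 + w2) f = chart_vec c p w1 f + chart_vec c p w2 f).
rewrite /chart_vec /on_germs; case: asboolP => _; last by rewrite addr0.
by rewrite -big_split; apply: eq_bigr => j _; rewrite mxE mulrDl.
Qed.

Lemma chart_vecZ c p r w : chart_vec c p (r *: w) = r *: chart_vec c p w.
Proof.
apply: funext => f.
change (chart_vec c p (r *: w) f = r * chart_vec c p w f).
rewrite /chart_vec /on_germs; case: asboolP => _; last by rewrite mulr0.
by rewrite mulr_sumr; apply: eq_bigr => j _; rewrite mxE mulrA.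
Qed.

Lemma tangentD p u v : tangent p u -> tangent p v -> tangent p (u + v).
Proof.
have [c ac cp] := atlas_cover p.
move=> /(tangent_chart_vec ac cp)[w1 ->] /(tangent_chart_vec ac cp)[w2 ->].
by rewrite -chart_vecD; exact: chart_vec_tangent.
Qed.

Lemma tangentZ p r u : tangent p u -> tangent p (r *: u).
Proof.
have [c ac cp] := atlas_cover p.
move=> /(tangent_chart_vec ac cp)[w ->].
by rewrite -chart_vecZ; exact: chart_vec_tangent.
Qed.

Lemma tangent0 p : tangent p 0.
Proof.
have [c ac cp] := atlas_cover p.
rewrite -(scale0r (chart_vec c p 0)); apply: tangentZ.
exact: chart_vec_tangent.
Qed.

Lemma tangentN p u : tangent p u -> tangent p (- u).
Proof. by move=> pu; rewrite -scaleN1r; exact: tangentZ. Qed.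

Lemma tangentB p u v : tangent p u -> tangent p v -> tangent p (u - v).
Proof. by move=> pu pv; apply: tangentD => //; exact: tangentN. Qed.

Lemma tangent_sum p (J : Type) (r : seq J) (P : pred J) (u : J -> tvec R M) :
  (forall j, P j -> tangent p (u j)) -> tangent p (\sum_(j <- r | P j) u j).
Proof.
move=> pu; apply: (big_ind (fun v => tangent p v)) => //; first exact: tangent0.
by move=> ? ?; exact: tangentD.
Qed.

Lemma tangent_cst p u r : tangent p u -> u (fun=> r) = 0.
Proof.
have [c ac cp] := atlas_cover p.
move=> /(tangent_chart_vec ac cp)[w ->].
rewrite /chart_vec /on_germs; case: asboolP => // _; apply: big1 => j _.
by rewrite (_ : _ \o _ = cst r)// derive_cst mulr0.
Qed.

Lemma tangent_nonsmooth p u f : tangent p u -> ~ smooth_near p f -> u f = 0.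
Proof.
have [c ac cp] := atlas_cover p.
move=> /(tangent_chart_vec ac cp)[w ->] sf.
by rewrite /chart_vec /on_germs; case: asboolP.
Qed.

Lemma tangent_coordE c p u : atlas c -> chart_dom c p -> tangent p u ->
  u = chart_vec c p (\row_i u (fun q => chart_map c q 0 i)).
Proof.
move=> ac cp /(tangent_chart_vec ac cp)[w ->]; congr chart_vec.
by apply/rowP => i; rewrite mxE chart_vec_coord.
Qed.

Lemma velocity_tangent (D : set R) (g : R -> M) t : dense_in_itself D ->
  smooth_curve D g -> D t -> tangent (g t) (velocity D g t).
Proof.
move=> pD sg Dt; have [c ac ct] := atlas_cover (g t).
by rewrite (velocityE pD sg Dt ac ct); exact: chart_vec_tangent.
Qed.

End TangentVectors.

(** * Translations and left-invariant fields *)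

Section ProductCharts.
Context {R : realType} {n : nat} {G : lieGroupType R n}.
Implicit Types (c d e : chart R n G) (f : G -> R) (U : set G).

Definition chart_pair c d : set 'rV[R]_(n + n) :=
  [set z | chart_img c (lsubmx z) /\ chart_img d (rsubmx z)].

Lemma lsubmx_cvg (z : 'rV[R]_(n + n)) : lsubmx @ nbhs z --> lsubmx z.
Proof.
apply: cvg_rV => j; rewrite (_ : (fun y => _) = fun y : 'rV[R]_(n + n) =>
  y 0 (lshift n j)).
  by rewrite mxE; exact: coord_continuous.
by apply: funext => y; rewrite mxE.
Qed.

Lemma rsubmx_cvg (z : 'rV[R]_(n + n)) : rsubmx @ nbhs z --> rsubmx z.
Proof.
apply: cvg_rV => j; rewrite (_ : (fun y => _) = fun y : 'rV[R]_(n + n) =>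
  y 0 (rshift n j)).
  by rewrite mxE; exact: coord_continuous.
by apply: funext => y; rewrite mxE.
Qed.

Lemma chart_pair_open c d : open (chart_pair c d).
Proof.
rewrite openE => z [cz dz].
have Nc : nbhs z (fun y => chart_img c (lsubmx y)).
  by apply: (@lsubmx_cvg z); apply: open_nbhs_nbhs; split=> //;
    exact: chart_img_open.
have Nd : nbhs z (fun y => chart_img d (rsubmx y)).
  by apply: (@rsubmx_cvg z); apply: open_nbhs_nbhs; split=> //;
    exact: chart_img_open.
exact: filterI Nc Nd.
Qed.

Lemma smooth_lsubmx c d : atlas c -> smooth_map (E := rV_space R (n + n))
  (chart_pair c d) (chart_inv c \o lsubmx).
Proof.
move=> ac; apply: smooth_map_chart_inv => //.
- exact/open_dopen/chart_pair_open.
- by move=> z [].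
- move=> i k; rewrite (_ : (fun y => _) = fun y : 'rV[R]_(n + n) =>
  y 0 (lshift n i)).
    exact/Ck_on_coord/chart_pair_open.
  by apply: funext => y; rewrite mxE.
Qed.

Lemma smooth_rsubmx c d : atlas d -> smooth_map (E := rV_space R (n + n))
  (chart_pair c d) (chart_inv d \o rsubmx).
Proof.
move=> ac; apply: smooth_map_chart_inv => //.
- exact/open_dopen/chart_pair_open.
- by move=> z [].
- move=> i k; rewrite (_ : (fun y => _) = fun y : 'rV[R]_(n + n) =>
  y 0 (rshift n i)).
    exact/Ck_on_coord/chart_pair_open.
  by apply: funext => y; rewrite mxE.
Qed.

End ProductCharts.

Lemma dopen_rV (R : realType) (n : nat) (U : set 'rV[R]_n) :
  dopen (E := rV_space R n) U -> open U.
Proof. by move=> oU; rewrite openE => x /oU[]. Qed.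

Section GroupSmooth.
Context {R : realType} {E : diff_space R} {n : nat} {G : lieGroupType R n}.
Implicit Types (S : set E) (F K : E -> G).

Lemma cvg_mulg (T : Type) (Z : set_system T) {FZ : Filter Z} (F K : T -> G)
    (x y : G) :
  F @ Z --> x -> K @ Z --> y -> (fun t => F t * K t)%g @ Z --> (x * y)%g.
Proof.
move=> Fx Ky; have FK : (fun t => (F t, K t)) @ Z --> (x, y) by exact: cvg_pair.
have c : (fun z : G * G => (z.1 * z.2)%g) @ nbhs (x, y) --> (x * y)%g.
  exact: (@mulg_continuous _ _ G (x, y)).
exact: cvg_comp FK c.
Qed.

(** Smoothness of the multiplication is given in terms of three charts. Near each point the domain
    is cut down, openly by continuity, until [F], [K] and their product each stay in one chart; the
    two coordinate rows are then joined and composed with the multiplication in coordinates. *)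
Lemma smooth_mapM S F K : dopen S -> smooth_map S F -> smooth_map S K ->
  smooth_map S (fun x => F x * K x)%g.
Proof.
move=> oS sF sK; have [cF _] := sF; have [cK _] := sK.
have cFK x : S x -> (fun x => F x * K x)%g @ dnear x --> (F x * K x)%g.
  move=> Sx; have NF := dnear_filter x.
  by apply: cvg_mulg; [exact: cF|exact: cK].
apply: smooth_map_of => // x Sx.
have [c ac cx] := atlas_cover (F x); have [d ad dx] := atlas_cover (K x).
have [e ae ex] := atlas_cover (F x * K x)%g.
pose S1 := S `&` F @^-1` chart_dom c.
pose S2 := S1 `&` K @^-1` chart_dom d.
pose S3 := S2 `&` (fun x => F x * K x)%g @^-1` chart_dom e.
have o1 : dopen S1 by apply: dopen_smooth_preimage => //; exact: chart_dom_open.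
have o2 : dopen S2.
  apply: dopen_smooth_preimage => //; last exact: chart_dom_open.
  by move=> y [Sy _]; exact: cK.
have o3 : dopen S3.
  apply: dopen_smooth_preimage => //; last exact: chart_dom_open.
  by move=> y [[Sy _] _]; exact: cFK.
exists e, S3; split=> // [y []//|i k].
have W := mulg_smooth e ae i c d ac ad.
pose inv (z : 'rV[R]_(n + n)) := (chart_inv c (lsubmx z) * chart_inv d (rsubmx
  z))%g.
pose U := chart_pair c d `&` inv @^-1` chart_dom e.
have oU : open U.
  apply: dopen_rV; apply: dopen_smooth_preimage.
  - exact/open_dopen/chart_pair_open.
  - move=> z cdz; apply: cvg_mulg.
      by have [+ _] := @smooth_lsubmx _ _ _ c d ac; apply.
    by have [+ _] := @smooth_rsubmx _ _ _ c d ad; apply.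
  - exact: chart_dom_open.
apply: (@eq_Ck_on _ _ _ _ ((fun z => chart_map e (inv z) 0 i) \o
    (fun y => row_mx (chart_map c (F y)) (chart_map d (K y))))) => //.
  move=> y [[[_ cy] dy] _] /=.
  by rewrite /inv row_mxKl row_mxKr !chart_mapK.
apply: (@Ck_on_comp _ _ _ _ _ U) => //.
- move=> y [[[_ cy] dy] ey]; rewrite /U /chart_pair /inv /= row_mxKl row_mxKr
  !chart_mapK//.
  by do !split=> //; exact: chart_map_img.
- have -> : U = [set z | [/\ chart_img c (lsubmx z), chart_img d (rsubmx z) &
    [set x : G * G | chart_dom e (x.1 * x.2)%g]
      (chart_inv c (lsubmx z), chart_inv d (rsubmx z))]].
    by apply/seteqP; split=> z; [move=> [[? ?] ?]|move=> [? ? ?]].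

  exact: (W k).
- move=> j; have [j' ->|j' ->] := split_ordP j.
    rewrite (_ : (fun y => _) = fun y => chart_map c (F y) 0 j').
      apply: (@Ck_on_sub _ _ _ S1) => [y [[]]//|].
      by have [_] := sF; apply.
    by apply: funext => y; rewrite row_mxEl.
  rewrite (_ : (fun y => _) = fun y => chart_map d (K y) 0 j').
    apply: (@Ck_on_sub _ _ _ (S `&` K @^-1` chart_dom d)) => [y [[[]]]//|].
    by have [_] := sK; apply.
  by apply: funext => y; rewrite row_mxEr.
Qed.

Lemma smooth_mapV S F : dopen S -> smooth_map S F ->
  smooth_map S (fun x => (F x)^-1)%g.
Proof.
move=> oS sF; have [cF _] := sF.
have cF' x : S x -> (fun x => (F x)^-1)%g @ dnear x --> ((F x)^-1)%g.
  move=> Sx; have c : (fun y : G => (y^-1)%g) @ nbhs (F x) --> ((F x)^-1)%g.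
    exact: (@invg_continuous _ _ G (F x)).
  exact: cvg_comp (cF x Sx) c.
apply: smooth_map_of => // x Sx.
have [e ae ex] := atlas_cover ((F x)^-1)%g.
pose U := [set y : G | chart_dom e (y^-1)%g].
have oU : open U.
  by apply: open_comp (@chart_dom_open _ _ _ e) => y _; exact: invg_continuous.
have o1 : dopen (S `&` F @^-1` U) by exact: dopen_smooth_preimage.
exists e, (S `&` F @^-1` U); split=> // [y []//|i k].
apply: (@smooth_map_comp _ _ _ _ _ _ U
  (fun y => chart_map e (y^-1)%g 0 i)) => //.
- by apply: smooth_map_sub sF => y [].
- by move=> y [].
- exact: invg_smooth.
Qed.

End GroupSmooth.

Section Translations.
Context {R : realType} {n : nat} {G : lieGroupType R n}.
Implicit Types (x p : G) (f : G -> R) (U : set G) (u v xi : tvec R G).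

Lemma mulg_open x U : open U -> open [set y | U (x * y)%g].
Proof.
move=> oU; apply: (@open_comp _ _ (fun y => (x * y)%g)) oU => y _.
by apply: cvg_mulg; [exact: cvg_cst|exact: cvg_id].
Qed.

Lemma smooth_on_translate x U f : open U -> smooth_on U f ->
  smooth_on [set y | U (x * y)%g] (fun y => f (x * y)%g).
Proof.
move=> oU fU; apply/smooth_onP => c k ac.
have oS : dopen (E := rV_space R n) (chart_set c [set y | U (x * y)%g]).
  exact/open_dopen/chart_set_open/mulg_open.
apply: (@smooth_map_comp _ (rV_space R n) _ _ _ (fun z =>
  x * chart_inv c z)%g U f) => //.
  apply: smooth_mapM => //; first exact: smooth_map_cst.
  apply: (@smooth_map_chart_inv _ (rV_space R n) _ _ _ c id) =>
    // [z []//|i k'].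
  exact/Ck_on_coord/chart_set_open/mulg_open.
by move=> z [].
Qed.

(** This lets the truncation [on_germs] commute with pushing forward along a translation. One
    direction is the other one for the inverse element. *)
Lemma smooth_near_translate x p f :
  smooth_near p (fun y => f (x * y)%g) <-> smooth_near (x * p)%g f.
Proof.
split=> -[U [oU Up fU]]; last first.
  exists [set y | U (x * y)%g]; split=> //; first exact: mulg_open.
  exact: smooth_on_translate.
exists [set y | U (x^-1 * y)%g]; split; first exact: mulg_open.
  by rewrite /= mulgA mulVg mul1g.
rewrite (_ : f = fun y => f (x * (x^-1 * y))%g).
  exact: (@smooth_on_translate _ _ (fun y => f (x * y)%g)).
by apply: funext => y; rewrite mulgA mulgV mul1g.
Qed.

Lemma velocity_translate x (D : set R) (g : R -> G) t :
  velocity D (fun s => x * g s)%g t = Lpush x (velocity D g t).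
Proof.
apply: funext => f; rewrite /velocity /Lpush /on_germs.
congr (if _ then _ else _).
by apply: asbool_equiv_eq; apply: iff_sym; exact: smooth_near_translate.
Qed.

Lemma smooth_curve_translate x (D : set R) (g : R -> G) : dense_in_itself D ->
  smooth_curve D g -> smooth_curve D (fun s => x * g s)%g.
Proof.
move=> pD /smooth_curveP sg; apply/(smooth_curveP pD); apply: smooth_mapM.
- exact: dopenT.
- by apply: smooth_map_cst; exact: dopenT.
- exact: sg.
Qed.

Lemma Lpush_tangent x p u : tangent p u -> tangent (x * p)%g (Lpush x u).
Proof.
move=> [e [g [e0 sg <- ->]]]; exists e, (fun s => x * g s)%g; split=> //.
  apply: smooth_curve_translate => //.
  by apply: open_dense_in_itself; exact: interval_open.
by rewrite velocity_translate.
Qed.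

Lemma LpushM x y u : Lpush x (Lpush y u) = Lpush (x * y)%g u.
Proof.
apply: funext => f; congr (u _).
by apply: funext => z; rewrite mulgA.
Qed.

Lemma Lpush1 u : Lpush 1%g u = u.
Proof. by apply: funext => f; congr (u _); apply: funext => z;
  rewrite mul1g. Qed.

Lemma LpushK x : cancel (@Lpush R n G x) (Lpush x^-1%g).
Proof. by move=> u; rewrite LpushM mulVg Lpush1. Qed.

Lemma LpushVK x : cancel (@Lpush R n G x^-1%g) (Lpush x).
Proof. by move=> u; rewrite LpushM mulgV Lpush1. Qed.

Lemma Lpush_sum x (J : Type) (r : seq J) (P : pred J) (u : J -> tvec R G) :
  Lpush x (\sum_(j <- r | P j) u j) = \sum_(j <- r | P j) Lpush x (u j).
Proof.
by apply: (big_morph (Lpush x) (id1 := 0) (op1 := +%R)).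
Qed.

Lemma lie_algebra_Lpush p u : tangent p u -> lie_algebra (Lpush p^-1%g u).
Proof. by move=> /(Lpush_tangent p^-1%g); rewrite mulVg. Qed.

Lemma left_field_tangent xi p : lie_algebra xi -> tangent p (left_field xi p).
Proof. by move=> /(Lpush_tangent p); rewrite mulg1. Qed.

(** Turns a derivative in the second group variable, with the first one frozen, into a partial
    derivative of a function of 2n variables, whose joint smoothness is known. *)
Lemma derive_row_mx (f : 'rV[R]_(n + n) -> R) (w z : 'rV[R]_n) j :
  'D_(delta_mx 0 j) (fun y => f (row_mx w y)) z
  = 'D_(delta_mx 0 (rshift n j)) f (row_mx w z).
Proof.
rewrite /derive; apply: (congr1 (fun q => lim (q @ 0^')));
  apply: funext => h /=.
congr (_ *: (f _ - _)); apply/rowP => i; rewrite !mxE eqxx/=.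
have [i' ->|i' ->] := split_ordP i.
  rewrite (_ : (lshift n i' == rshift n j) = false) ?mulr0 ?add0r//.
  by apply/eqP => /eqP; rewrite eq_lrshift.
by rewrite !mxE eqxx/= eq_rshift.
Qed.

(* In product charts, x |-> xi (y |-> f (x y)) is a combination of the partial
   derivatives of f (x y) in the second variable, restricted to y = 1. *)
Lemma left_field_vector_field xi : lie_algebra xi ->
  vector_field (left_field xi).
Proof.
move=> lxi; split=> [p|U f oU fU]; first exact: left_field_tangent.
have [d ad d1] := atlas_cover (1%g : G).
have [w xiE] := tangent_chart_vec ad d1 lxi.
apply/smooth_onP => c k ac.
have oc : open (chart_set c U) by exact: chart_set_open.
pose inv (z : 'rV[R]_(n + n)) := (chart_inv c (lsubmx z) * chart_inv d (rsubmx
  z))%g.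
have sinv : smooth_map (E := rV_space R (n + n)) (chart_pair c d) inv.
  apply: (smooth_mapM (E := rV_space R (n + n)) (F := chart_inv c \o lsubmx)
    (K := chart_inv d \o rsubmx)).
  - exact/open_dopen/chart_pair_open.
  - exact: smooth_lsubmx.
  - exact: smooth_rsubmx.
pose W := chart_pair c d `&` inv @^-1` U.
have oW : open W.
  apply: dopen_rV; apply: dopen_smooth_preimage => //.
    exact/open_dopen/chart_pair_open.
  by have [] := sinv.
have Phi m : Ck_on (E := rV_space R (n + n)) m W (f \o inv).
  apply: (@smooth_map_comp _ (rV_space R (n + n)) _ _ _ _ U) => //;
    first exact: open_dopen.
    by apply: smooth_map_sub sinv => z [].
  by move=> z [].
apply: (@eq_Ck_on _ (rV_space R n) _ _ (fun y : 'rV[R]_n => \sum_j w 0 j *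
   'D_(delta_mx 0 (rshift n j)) (f \o inv) (row_mx y (chart_map d 1%g)))).
- exact: open_dopen.
- move=> y [cy Uy]; rewrite /= /left_field /Lpush xiE /chart_vec /on_germs.
  case: asboolP => [_|]; last first.
    by case; apply/smooth_near_translate; rewrite mulg1; exists U.
  apply: eq_bigr => j _; congr (_ * _); rewrite -derive_row_mx.
  congr ('D_ _ _ _); apply: funext => z /=.
  by rewrite /inv row_mxKl row_mxKr.
apply: Ck_on_sum => [|j]; first exact: open_dopen.
apply: Ck_onM; [exact: open_dopen|exact/Ck_on_cst/open_dopen|].
apply: (@Ck_on_comp _ (rV_space R n) _ _ _ W (fun z =>
  'D_(delta_mx 0 (rshift n j)) (f \o inv) z)
  (fun y => row_mx y (chart_map d 1%g))) => //.
- exact: open_dopen.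
- move=> y [cy Uy]; rewrite /W /chart_pair /inv /= row_mxKl row_mxKr.
  split; last by rewrite chart_mapK// mulg1.
  by split=> //; exact: chart_map_img.
- by have /Ck_on_rV [_ /(_ (rshift n j))[_]] := Phi k.+1.
move=> i; have [i' ->|i' ->] := split_ordP i.
  rewrite (_ : (fun y => _) = fun y : 'rV[R]_n => y 0 i');
    first exact: Ck_on_coord.
  by apply: funext => y; rewrite row_mxEl.
rewrite (_ : (fun y => _) = fun=> chart_map d 1%g 0 i').
  exact/Ck_on_cst/open_dopen.
by apply: funext => y; rewrite row_mxEr.
Qed.

End Translations.

(** * The global frame of left-invariant fields *)

Section Frame.
Context {R : realType} {n : nat} {G : lieGroupType R n}.
Implicit Types (p x : G) (u v w : tvec R G) (X Y Z : G -> tvec R G).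

Definition unit_chart : chart R n G := s2val (cid2 (atlas_cover (1%g : G))).

Lemma unit_chart_atlas : atlas unit_chart.
Proof. exact: s2valP (cid2 (atlas_cover (1%g : G))). Qed.

Lemma unit_chart_dom : chart_dom unit_chart 1%g.
Proof. exact: s2valP' (cid2 (atlas_cover (1%g : G))). Qed.

Definition lie_basis (i : 'I_n) : tvec R G :=
  chart_vec unit_chart 1%g (delta_mx 0 i).

(** Evaluation at a coordinate function, hence defined and linear on all functionals and not only on
    the Lie algebra. *)
Definition lie_coord (i : 'I_n) u : R := u (fun q =>
  chart_map unit_chart q 0 i).

Lemma lie_basis_in i : lie_algebra (lie_basis i).
Proof.
by apply: chart_vec_tangent; [exact: unit_chart_atlas|exact: unit_chart_dom].
Qed.

Lemma lie_coord_basis i j : lie_coord i (lie_basis j) = (i == j)%:R.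
Proof.
rewrite /lie_coord /lie_basis chart_vec_coord ?mxE ?eqxx//;
  first exact: unit_chart_atlas.
exact: unit_chart_dom.
Qed.

Lemma lie_coord_sum i (a : 'I_n -> R) :
  lie_coord i (\sum_j a j *: lie_basis j) = a i.
Proof.
rewrite /lie_coord fct_sumE (bigD1 i)//= big1 ?addr0 => [|j ji].
  have E : lie_coord i (lie_basis i) = 1 by rewrite lie_coord_basis eqxx.
  by rewrite -[RHS]mulr1 -E.
have E : lie_coord i (lie_basis j) = 0.
  by rewrite lie_coord_basis eq_sym (negbTE ji).
by rewrite -[RHS](mulr0 (a j)) -E.
Qed.

Lemma lie_coordE u : lie_algebra u -> u = \sum_i lie_coord i u *: lie_basis i.
Proof.
move=> /(tangent_coordE unit_chart_atlas unit_chart_dom) uE.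
rewrite {1}uE; set w := \row_i _.
rewrite {1}(row_sum_delta w) (big_morph _ (chart_vecD unit_chart 1%g)
  (id1 := 0) (op1 := +%R)).
  by apply: eq_bigr => i _; rewrite chart_vecZ mxE.
by rewrite -(scale0r 0) chart_vecZ scale0r.
Qed.

Lemma tangent_left_field p u : u = left_field (Lpush p^-1%g u) p.
Proof. by rewrite /left_field LpushVK. Qed.

Lemma tangent_frameE p u : tangent p u ->
  u = \sum_i lie_coord i (Lpush p^-1%g u) *: left_field (lie_basis i) p.
Proof.
move=> /lie_algebra_Lpush/lie_coordE uE.
by rewrite [LHS](tangent_left_field p u) [in LHS]uE /left_field Lpush_sum.
Qed.

Lemma lie_algebra_comb (a : 'I_n -> R) :
  lie_algebra (\sum_i a i *: lie_basis i).
Proof. by apply: tangent_sum => i _; apply/tangentZ/lie_basis_in. Qed.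

Lemma vector_field0 : vector_field (0 : G -> tvec R G).
Proof.
split=> [p|U f oU _]; [exact: tangent0|exact: smooth_on_cst].
Qed.

Lemma vector_fieldD X Y : vector_field X -> vector_field Y ->
  vector_field (X + Y).
Proof.
move=> [tX sX] [tY sY]; split=> [p|U f oU fU]; first exact: tangentD.
by apply: smooth_onD => //; [exact: sX|exact: sY].
Qed.

Lemma vector_fieldM (f : G -> R) X : smooth_fun f -> vector_field X ->
  vector_field (fun p => f p *: X p).
Proof.
move=> sf [tX sX]; split=> [p|U k oU kU]; first exact: tangentZ.
apply: smooth_onM => //; last exact: sX.
by apply: smooth_on_sub sf.
Qed.

Lemma smooth_fun_cst (r : R) : smooth_fun ((fun=> r) : G -> R).
Proof. by apply: smooth_on_cst; exact: openT. Qed.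

Lemma vector_fieldZ (r : R) X : vector_field X -> vector_field (r *: X).
Proof. by apply: (@vector_fieldM (fun=> r)); exact: smooth_fun_cst. Qed.

Lemma vector_fieldN X : vector_field X -> vector_field (- X).
Proof. by rewrite -scaleN1r; exact: vector_fieldZ. Qed.

Lemma vector_fieldB X Y : vector_field X -> vector_field Y ->
  vector_field (X - Y).
Proof. by move=> vX vY; apply: vector_fieldD => //; exact: vector_fieldN. Qed.

Lemma vector_field_sum (J : Type) (r : seq J) (P : pred J)
    (X : J -> G -> tvec R G) : (forall j, vector_field (X j)) ->
  vector_field (\sum_(j <- r | P j) X j).
Proof.
move=> vX; apply: (big_ind vector_field) => //; first exact: vector_field0.
by move=> ? ?; exact: vector_fieldD.
Qed.

Section Metric.
Variable met : G -> tvec R G -> tvec R G -> R.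
Hypotheses (rmet : riemannian_metric met) (lmet : left_invariant met).

Lemma metC p u v : tangent p u -> tangent p v -> met p u v = met p v u.
Proof. by have [+ _ _ _] := rmet; exact. Qed.

Lemma metDl p u v w : tangent p u -> tangent p v -> tangent p w ->
  met p (u + v) w = met p u w + met p v w.
Proof.
by have [_ + _ _] := rmet => /(_ p 1 u v w); rewrite scale1r mul1r.
Qed.

Lemma met0l p w : tangent p w -> met p 0 w = 0.
Proof.
move=> pw; have := metDl (tangent0 p) (tangent0 p) pw.
by rewrite addr0 => /eqP; rewrite -subr_eq0 opprD addrA subrr sub0r oppr_eq0 =>
  /eqP.
Qed.

Lemma metZl p r u w : tangent p u -> tangent p w ->
  met p (r *: u) w = r * met p u w.
Proof.
move=> pu pw; have [_ + _ _] := rmet => /(_ p r u 0 w pu (tangent0 p) pw).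
by rewrite addr0 met0l// addr0.
Qed.

Lemma metBl p u v w : tangent p u -> tangent p v -> tangent p w ->
  met p (u - v) w = met p u w - met p v w.
Proof.
move=> pu pv pw; rewrite metDl//; last exact: tangentN.
by rewrite -scaleN1r metZl// mulN1r.
Qed.

Lemma met_suml p (J : Type) (r : seq J) (a : J -> R) (u : J -> tvec R G) w :
  (forall j, tangent p (u j)) -> tangent p w ->
  met p (\sum_(j <- r) a j *: u j) w = \sum_(j <- r) a j * met p (u j) w.
Proof.
move=> pu pw; elim: r => [|j r IH]; first by rewrite !big_nil met0l.
rewrite !big_cons metDl ?metZl ?IH//; first exact: tangentZ.
by apply: tangent_sum => i _; exact: tangentZ.
Qed.

Lemma met_inj p u v : tangent p u -> tangent p v ->
  (forall w, tangent p w -> met p u w = met p v w) -> u = v.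
Proof.
move=> pu pv uv; apply/eqP; rewrite -subr_eq0; apply/negP => /negP uv0.
have [_ _ /(_ p (u - v) (tangentB pu pv) uv0) + _] := rmet.
by rewrite metBl ?uv ?subrr ?ltxx//; exact: tangentB.
Qed.

Lemma met_left_field p u v : lie_algebra u -> lie_algebra v ->
  met p (left_field u p) (left_field v p) = met 1%g u v.
Proof. by move=> lu lv; rewrite -(lmet p lu lv) mulg1. Qed.

Definition gram : 'M[R]_n := \matrix_(i, j) met 1%g (lie_basis i) (lie_basis j).

(** A row in the kernel of the Gram matrix is the coordinate row of a vector orthogonal to the whole
    Lie algebra, which vanishes because the metric is definite. *)
Lemma gram_unit : gram \in unitmx.
Proof.
rewrite -row_free_unit -kermx_eq0; apply/eqP/row_matrixP => k.
have : row k (kermx gram) *m gram = 0 by rewrite -row_mul mulmx_ker row0.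
move: (row k _) => v vg; rewrite row0.
pose u := \sum_i v 0 i *: lie_basis i.
have lu : lie_algebra u by exact: (lie_algebra_comb (v 0)).
have u0 : u = 0.
  apply: (@met_inj 1%g) => //; first exact: tangent0.
  move=> w lw; rewrite met0l// metC// (lie_coordE lw) met_suml//; last first.
    by move=> j; exact: lie_basis_in.
  apply: big1 => j _; rewrite metC//; last exact: lie_basis_in.
  have := congr1 (fun m : 'rV[R]_n => m 0 j) vg; rewrite !mxE => vgj.
  rewrite /u met_suml//; [|by move=> i;
    exact: lie_basis_in|exact: lie_basis_in].
  by rewrite (eq_bigr (fun i => v 0 i * gram i j)) ?vgj ?mulr0// => i _;
    rewrite mxE.
by apply/rowP => i; rewrite mxE -(lie_coord_sum i (v 0)) -/u u0.
Qed.

(** The coefficients solve a linear system whose matrix, by left invariance, is at every [p] the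
    Gram matrix at the identity. *)
Lemma riesz p (phi : 'I_n -> R) : exists2 z, tangent p z &
  forall j, met p z (left_field (lie_basis j) p) = phi j.
Proof.
pose a := (\row_j phi j) *m invmx gram.
have tE j : tangent p (left_field (lie_basis j) p).
  by apply: left_field_tangent; exact: lie_basis_in.
exists (\sum_i a 0 i *: left_field (lie_basis i) p).
  by apply: tangent_sum => i _; exact: tangentZ.
move=> j; rewrite met_suml//.
have : (a *m gram) 0 j = phi j by rewrite mulmxKV ?gram_unit// mxE.
rewrite mxE => <-; apply: eq_bigr => i _.
by rewrite [gram i j]mxE met_left_field//; exact: lie_basis_in.
Qed.

(** [grad] is a choice with default value 0, so its defining property has to be earned by exhibiting
    a Riesz vector. *)
Lemma gradP f p : tangent p (grad met f p) /\
  forall w, tangent p w -> met p (grad met f p) w = w f.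
Proof.
apply: (xgetPex 0 (P := [set v | tangent p v /\
  forall w, tangent p w -> met p v w = w f])).
have [z pz zE] := riesz p (fun j => left_field (lie_basis j) p f).
have tE j : tangent p (left_field (lie_basis j) p).
  by apply: left_field_tangent; exact: lie_basis_in.
exists z; split=> // w pw; rewrite metC// (tangent_frameE pw) met_suml//.
by rewrite fct_sumE; apply: eq_bigr => j _; rewrite metC// zE.
Qed.

(* The Gram matrix of the left-invariant frame is the same at all points. *)
Lemma frame_coord X p i : vector_field X ->
  lie_coord i (Lpush p^-1%g (X p)) = \sum_j
    met p (X p) (left_field (lie_basis j) p) * invmx gram j i.
Proof.
move=> [/(_ p) tX _]; have tE j : tangent p (left_field (lie_basis j) p).
  by apply: left_field_tangent; exact: lie_basis_in.
set a := \row_i lie_coord i (Lpush p^-1%g (X p)).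
have aE : X p = \sum_i a 0 i *: left_field (lie_basis i) p.
  by rewrite {1}(tangent_frameE tX); apply: eq_bigr => k _; rewrite mxE.
have : (a *m gram *m invmx gram) 0 i = a 0 i by rewrite mulmxK ?gram_unit.
rewrite [a 0 i]mxE => <-; rewrite mxE; apply: eq_bigr => j _; congr (_ * _).
rewrite mxE aE met_suml//; apply: eq_bigr => k _.
by rewrite [gram k j]mxE met_left_field//; exact: lie_basis_in.
Qed.

(** The coefficient involves [Lpush p^-1], which moves with [p]. Writing it through inner products
    of vector fields and a constant matrix reduces the claim to the smoothness axiom of the
    metric. *)
Lemma frame_coord_smooth X i : vector_field X ->
  smooth_fun (fun p => lie_coord i (Lpush p^-1%g (X p))).
Proof.
move=> vX; rewrite (_ : (fun p => _) = fun p => \sum_j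
    met p (X p) (left_field (lie_basis j) p) * invmx gram j i); last first.
  by apply: funext => p; exact: frame_coord.
apply: smooth_on_sum => [|j]; first exact: openT.
apply: smooth_onM; [exact: openT| |exact: smooth_fun_cst].
have [_ _ _] := rmet; apply => //; apply: left_field_vector_field.
exact: lie_basis_in.
Qed.

Lemma vector_field_frameE X : vector_field X -> X = \sum_i
  (fun p => lie_coord i (Lpush p^-1%g (X p)) *: left_field (lie_basis i) p).
Proof.
move=> [tX _]; apply: funext => p; rewrite fct_sumE.
by rewrite {1}(tangent_frameE (tX p)).
Qed.

(* Two vector fields that agree at [p] have the same coefficients at [p] in the
   global frame of left-invariant fields. *)
Lemma tensorial (T : (G -> tvec R G) -> tvec R G) p X Y :
  (forall X Y, vector_field X -> vector_field Y -> T (X + Y) = T X + T Y) ->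
  (forall f X, smooth_fun f -> vector_field X ->
    T (fun q => f q *: X q) = f p *: T X) ->
  vector_field X -> vector_field Y -> X p = Y p -> T X = T Y.
Proof.
move=> TD TM vX vY XY.
have vE i : vector_field (left_field (lie_basis i)).
  by apply: left_field_vector_field; exact: lie_basis_in.
have T0 : T 0 = 0.
  have := TD 0 0 vector_field0 vector_field0.
  by rewrite addr0 => /eqP; rewrite -subr_eq0 opprD addrA subrr sub0r oppr_eq0
    => /eqP.
have TE Z : vector_field Z -> T Z = \sum_i
    lie_coord i (Lpush p^-1%g (Z p)) *: T (left_field (lie_basis i)).
  move=> vZ; rewrite {1}(vector_field_frameE vZ).
  elim: (index_enum _) => [|i r IH]; first by rewrite !big_nil.
  rewrite !big_cons TD ?IH ?TM//; first exact: frame_coord_smooth.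
    by apply: vector_fieldM => //; exact: frame_coord_smooth.
  apply: vector_field_sum => j; apply: vector_fieldM => //.
  exact: frame_coord_smooth.
by rewrite !TE// XY.
Qed.

End Metric.
End Frame.

(** * The Levi-Civita connection of a left-invariant metric *)

Section LeviCivita.
Context {R : realType} {n : nat} {G : lieGroupType R n}.
Implicit Types (p x : G) (u v w : tvec R G) (X Y Z : G -> tvec R G).
Variables (met : G -> tvec R G -> tvec R G -> R)
  (nabla : (G -> tvec R G) -> (G -> tvec R G) -> (G -> tvec R G)).
Hypotheses (rmet : riemannian_metric met) (lmet : left_invariant met)
  (lc : levi_civita met nabla).

Local Notation ng := (nabla_lie nabla).

Lemma nabla_vector_field X Y : vector_field X -> vector_field Y ->
  vector_field (nabla X Y).
Proof. by have [[+ _ _ _ _] _ _] := lc; exact. Qed.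

Lemma nablaDl X1 X2 Y : vector_field X1 -> vector_field X2 -> vector_field Y ->
  nabla (X1 + X2) Y = nabla X1 Y + nabla X2 Y.
Proof. by have [[_ + _ _ _] _ _] := lc; exact. Qed.

Lemma nablaMl f X Y : smooth_fun f -> vector_field X -> vector_field Y ->
  nabla (fun p => f p *: X p) Y = (fun p => f p *: nabla X Y p).
Proof. by have [[_ _ + _ _] _ _] := lc; exact. Qed.

Lemma nablaDr X Y1 Y2 : vector_field X -> vector_field Y1 -> vector_field Y2 ->
  nabla X (Y1 + Y2) = nabla X Y1 + nabla X Y2.
Proof. by have [[_ _ _ + _] _ _] := lc; exact. Qed.

Lemma nablaMr f X Y : smooth_fun f -> vector_field X -> vector_field Y ->
  nabla X (fun p => f p *: Y p) = (fun p => X p f *: Y p + f p *: nabla X Y p).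
Proof. by have [[_ _ _ _ +] _ _] := lc; exact. Qed.

Lemma nablaZl (r : R) X Y : vector_field X -> vector_field Y ->
  nabla (r *: X) Y = r *: nabla X Y.
Proof. by apply: (@nablaMl (fun=> r)); exact: smooth_fun_cst. Qed.

Lemma nablaZr (r : R) X Y : vector_field X -> vector_field Y ->
  nabla X (r *: Y) = r *: nabla X Y.
Proof.
move=> vX vY; rewrite (@nablaMr (fun=> r))//; last exact: smooth_fun_cst.
apply: funext => p; have [tX _] := vX.
by rewrite (tangent_cst r (tX p)) scale0r add0r.
Qed.

Lemma nablaNl X Y : vector_field X -> vector_field Y ->
  nabla (- X) Y = - nabla X Y.
Proof. by move=> vX vY; rewrite -scaleN1r nablaZl// scaleN1r. Qed.

Lemma nablaBl X1 X2 Y : vector_field X1 -> vector_field X2 -> vector_field Y ->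
  nabla (X1 - X2) Y = nabla X1 Y - nabla X2 Y.
Proof.
by move=> v1 v2 vY; rewrite nablaDl ?nablaNl//; exact: vector_fieldN.
Qed.

Lemma torsion_free X Y : vector_field X -> vector_field Y ->
  bracket X Y = nabla X Y - nabla Y X.
Proof. by have [_ + _] := lc => /(_ X Y) H vX vY; rewrite H. Qed.

Lemma bracket_vector_field X Y : vector_field X -> vector_field Y ->
  vector_field (bracket X Y).
Proof.
by move=> vX vY; rewrite torsion_free//; apply: vector_fieldB;
  exact: nabla_vector_field.
Qed.

(** A left-invariant field commutes with left translation of functions, so bracketing at [p] and
    applying to [f] is bracketing at the identity and applying to [f] precomposed with translation
    by [p]. *)
Lemma bracket_left_field u v p :
  bracket (left_field u) (left_field v) p = Lpush p (lie_bracket u v).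
Proof.
apply: funext => f; rewrite /lie_bracket /Lpush /bracket /on_germs.
congr (if _ then _ else _).
  apply: asbool_equiv_eq; apply: iff_sym.
  by have := smooth_near_translate p 1%g f; rewrite mulg1.
have E a b : Lpush p a (fun q => Lpush q b f) =
    Lpush 1%g a (fun q => Lpush q b (fun y => f (p * y)%g)).
  rewrite Lpush1; congr (a _); apply: funext => y.
  by rewrite -LpushM.
by congr (_ - _); exact: E.
Qed.

Lemma lie_bracketE u v : lie_algebra u -> lie_algebra v ->
  lie_bracket u v = ng u v - ng v u.
Proof.
by move=> lu lv; rewrite /lie_bracket torsion_free//;
  exact: left_field_vector_field.
Qed.

Lemma nabla_lie_in u v : lie_algebra u -> lie_algebra v -> lie_algebra (ng u v).
Proof.
move=> lu lv; have [+ _] := nabla_vector_field (left_field_vector_field lu)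
  (left_field_vector_field lv).
exact.
Qed.

(** Metric compatibility: the inner product of two left-invariant fields is constant, so its
    derivative is 0. *)
Lemma nabla_left_skew p u v w : lie_algebra u -> lie_algebra v ->
  lie_algebra w ->
  met p (nabla (left_field u) (left_field v) p) (left_field w p)
  = - met p (nabla (left_field u) (left_field w) p) (left_field v p).
Proof.
move=> lu lv lw; have [_ _ H] := lc.
have vu := left_field_vector_field lu; have vv := left_field_vector_field lv.
have vw := left_field_vector_field lw.
have := H _ _ _ vu vv vw p.
rewrite (_ : (fun q => _) = fun=> met 1%g v w); last first.
  by apply: funext => q; exact: met_left_field.
rewrite (tangent_cst _ (left_field_tangent p lu)) => /esym/eqP.
rewrite addr_eq0 => /eqP ->; congr (- _); apply: (metC rmet).
  exact: left_field_tangent.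
by have [+ _] := nabla_vector_field vu vw; exact.
Qed.

Lemma nabla_left_torsion p u v w : lie_algebra u -> lie_algebra v ->
  lie_algebra w ->
  met p (nabla (left_field u) (left_field v) p) (left_field w p)
  - met p (nabla (left_field v) (left_field u) p) (left_field w p)
  = met 1%g (lie_bracket u v) w.
Proof.
move=> lu lv lw.
have vu := left_field_vector_field lu; have vv := left_field_vector_field lv.
have [tuv _] := nabla_vector_field vu vv;
  have [tvu _] := nabla_vector_field vv vu.
have lb : lie_algebra (lie_bracket u v).
  by rewrite lie_bracketE//; apply: tangentB; exact: nabla_lie_in.
rewrite -(metBl rmet)//; last exact: left_field_tangent.
rewrite -(met_left_field lmet p lb lw); congr (met p _ _).
by rewrite /left_field -bracket_left_field torsion_free.
Qed.

(* The Koszul formula, in which the metric terms are constant. *)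
Lemma nabla_left_field u v : lie_algebra u -> lie_algebra v ->
  nabla (left_field u) (left_field v) = left_field (ng u v).
Proof.
move=> lu lv; apply: funext => p; apply: (met_inj rmet (p := p)).
- have [+ _] := nabla_vector_field (left_field_vector_field lu)
    (left_field_vector_field lv).
  exact.
- by apply: left_field_tangent; exact: nabla_lie_in.
move=> w pw; rewrite (tangent_left_field p w).
have lw := lie_algebra_Lpush pw; move: (Lpush _ w) lw => {w pw} w lw.
rewrite (met_left_field lmet p (nabla_lie_in lu lv) lw).
rewrite -[in RHS](Lpush1 w) -[Lpush _ w]/(left_field w 1%g) /nabla_lie.
(* The cyclic instances of skewness and torsion-freeness give the same linear system at [p] and at
   the identity, with the same right-hand sides; eliminating as in Koszul equates the two
   solutions. *)
have := nabla_left_skew p lu lv lw; have := nabla_left_skew p lv lw lu.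
have := nabla_left_skew p lw lu lv; have := nabla_left_skew 1%g lu lv lw.
have := nabla_left_skew 1%g lv lw lu; have := nabla_left_skew 1%g lw lu lv.
have := nabla_left_torsion p lu lv lw; have := nabla_left_torsion p lv lw lu.
have := nabla_left_torsion p lw lu lv; have := nabla_left_torsion 1%g lu lv lw.
have := nabla_left_torsion 1%g lv lw lu;
  have := nabla_left_torsion 1%g lw lu lv.
by move=> *; lra.
Qed.

Lemma nabla_lieDl u v w : lie_algebra u -> lie_algebra v -> lie_algebra w ->
  ng (u + v) w = ng u w + ng v w.
Proof.
move=> lu lv lw; rewrite /nabla_lie.
rewrite (_ : left_field (u + v) = left_field u + left_field v)// nablaDl//;
  exact: left_field_vector_field.
Qed.

Lemma nabla_lieDr u v w : lie_algebra u -> lie_algebra v -> lie_algebra w ->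
  ng u (v + w) = ng u v + ng u w.
Proof.
move=> lu lv lw; rewrite /nabla_lie.
rewrite (_ : left_field (v + w) = left_field v + left_field w)// nablaDr//;
  exact: left_field_vector_field.
Qed.

Lemma nabla_lieZl r u v : lie_algebra u -> lie_algebra v ->
  ng (r *: u) v = r *: ng u v.
Proof.
move=> lu lv; rewrite /nabla_lie.
rewrite (_ : left_field (r *: u) = r *: left_field u)// nablaZl//;
  exact: left_field_vector_field.
Qed.

Lemma nabla_lieZr r u v : lie_algebra u -> lie_algebra v ->
  ng u (r *: v) = r *: ng u v.
Proof.
move=> lu lv; rewrite /nabla_lie.
rewrite (_ : left_field (r *: v) = r *: left_field v)// nablaZr//;
  exact: left_field_vector_field.
Qed.

Lemma nabla_lie_suml (J : Type) (r : seq J) (a : J -> R) (u : J -> tvec R G) v :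
  (forall j, lie_algebra (u j)) -> lie_algebra v ->
  ng (\sum_(j <- r) a j *: u j) v = \sum_(j <- r) a j *: ng (u j) v.
Proof.
move=> lu lv; elim: r => [|j r IH].
  by have := nabla_lieZl 0 (@tangent0 R n G 1%g) lv; rewrite !scale0r !big_nil.
rewrite !big_cons nabla_lieDl ?nabla_lieZl ?IH//; first exact: tangentZ (lu j).
by apply: tangent_sum => i _; exact: tangentZ (lu i).
Qed.

Lemma nabla_lie_sumr (J : Type) (r : seq J) (a : J -> R) (u : J -> tvec R G) v :
  (forall j, lie_algebra (u j)) -> lie_algebra v ->
  ng v (\sum_(j <- r) a j *: u j) = \sum_(j <- r) a j *: ng v (u j).
Proof.
move=> lu lv; elim: r => [|j r IH].
  by have := nabla_lieZr 0 lv (@tangent0 R n G 1%g); rewrite !scale0r !big_nil.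
rewrite !big_cons nabla_lieDr ?nabla_lieZr ?IH//; first exact: tangentZ (lu j).
by apply: tangent_sum => i _; exact: tangentZ (lu i).
Qed.

(** Skewness gives that [- ng u u] pairs with [zeta] as [ng u zeta] does with [u], and that
    [ng zeta u] is orthogonal to [u]; the difference of the two pairings is the one with the
    bracket. Definiteness of the metric then makes the choice in [ad_dagger] unique. *)
Lemma ad_daggerE u : lie_algebra u -> ad_dagger met u u = - ng u u.
Proof.
move=> lu; have luu : lie_algebra (ng u u) by exact: nabla_lie_in.
have spec zeta : lie_algebra zeta ->
    met 1%g (- ng u u) zeta = met 1%g u (lie_bracket u zeta).
  move=> lz; have luz := nabla_lie_in lu lz; have lzu := nabla_lie_in lz lu.
  rewrite lie_bracketE// (metC rmet lu (tangentB luz lzu)).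
  rewrite (metBl rmet luz lzu lu) -scaleN1r (metZl rmet _ luu lz) mulN1r.
  have := nabla_left_skew 1%g lu lz lu; have := nabla_left_skew 1%g lz lu lu.
  rewrite /left_field !Lpush1 -!/(left_field _) -!/(nabla_lie _ _ _).
  by move=> *; lra.
apply: xget_unique; first by split=> //; exact: tangentN.
move=> y [ly yE]; apply: (met_inj rmet (p := 1%g)) => // [|w lw].
  exact: tangentN.
by rewrite yE// spec.
Qed.

(** * Tensoriality and left invariance of the curvature *)

Section Curvature.

Let fieldD X Y p (f : G -> R) : (X + Y) p f = X p f + Y p f. Proof. by []. Qed.
Let fieldN X p (f : G -> R) : (- X) p f = - X p f. Proof. by []. Qed.
Let vecD u v (f : G -> R) : (u + v) f = u f + v f. Proof. by []. Qed.
Let vecN u (f : G -> R) : (- u) f = - u f. Proof. by []. Qed.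
Let vecZ r u (f : G -> R) : (r *: u) f = r * u f. Proof. by []. Qed.
Let fieldE := (fieldD, fieldN, vecD, vecN, vecZ).

Local Notation curv := (curvature nabla).

Lemma curvatureC X Y Z : vector_field X -> vector_field Y -> vector_field Z ->
  curv X Y Z = - curv Y X Z.
Proof.
move=> vX vY vZ; rewrite /curvature !torsion_free//.
rewrite -[nabla X Y - _]opprB nablaNl//; last by apply: vector_fieldB;
  exact: nabla_vector_field.
by rewrite !opprB opprK addrC addrA.
Qed.

Lemma curvatureDl X1 X2 Y Z p : vector_field X1 -> vector_field X2 ->
  vector_field Y -> vector_field Z ->
  curv (X1 + X2) Y Z p = curv X1 Y Z p + curv X2 Y Z p.
Proof.
move=> v1 v2 vY vZ; rewrite /curvature !torsion_free//;
  last exact: vector_fieldD.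
have v1Y := nabla_vector_field v1 vY; have vY1 := nabla_vector_field vY v1;
  have v2Y := nabla_vector_field v2 vY.
have vY2 := nabla_vector_field vY v2; have v1Z := nabla_vector_field v1 vZ;
  have v2Z := nabla_vector_field v2 vZ.
have vYZ := nabla_vector_field vY vZ.
have vB1 := vector_fieldB v1Y vY1; have vB2 := vector_fieldB v2Y vY2.
rewrite [nabla (X1 + X2) Y]nablaDl// [nabla Y (X1 + X2)]nablaDr//.
rewrite opprD addrACA [nabla (_ - _ + _) Z]nablaDl//
  [nabla (X1 + X2) Z]nablaDl//.
rewrite nablaDl// nablaDr//; apply: funext => f.
rewrite !fieldE/= ?fieldE; ring.
Qed.

(** The bracket of hX and Y is h[X, Y] - (Yh)X; its second term cancels the derivative of h coming
    from differentiating h times the derivative of Z along X. *)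
Lemma curvatureMl h X Y Z p : smooth_fun h -> vector_field X ->
  vector_field Y -> vector_field Z ->
  curv (fun q => h q *: X q) Y Z p = h p *: curv X Y Z p.
Proof.
move=> sh vX vY vZ; have vhX := vector_fieldM sh vX.
rewrite /curvature !torsion_free//.
have vXY := nabla_vector_field vX vY; have vYX := nabla_vector_field vY vX;
  have vXZ := nabla_vector_field vX vZ.
have vYZ := nabla_vector_field vY vZ; have vB := vector_fieldB vXY vYX.
have sYh : smooth_fun (fun q => Y q h) by have [_] := vY; apply => //;
  exact: openT.
rewrite [nabla (fun q => h q *: X q) Y]nablaMl//.
rewrite [nabla Y (fun q => h q *: X q)]nablaMr//.
rewrite [(fun q => h q *: nabla X Y q) - _](_ : _ = (fun q =>
  h q *: (nabla X Y - nabla Y X) q)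
   - (fun q => Y q h *: X q)); last first.
  apply: funext => q; apply: funext => f; rewrite !fieldE/= ?fieldE; ring.
rewrite (nablaBl (vector_fieldM sh vB) (vector_fieldM sYh vX) vZ).
rewrite !nablaMl// nablaMr//; apply: funext => f.
rewrite !fieldE/= ?fieldE; ring.
Qed.

Lemma curvatureDr X Y Z1 Z2 p : vector_field X -> vector_field Y ->
  vector_field Z1 -> vector_field Z2 ->
  curv X Y (Z1 + Z2) p = curv X Y Z1 p + curv X Y Z2 p.
Proof.
move=> vX vY v1 v2; have vB := bracket_vector_field vX vY.
rewrite /curvature ![nabla _ (Z1 + Z2)]nablaDr//.
rewrite ![nabla _ (_ + _)]nablaDr//; try exact: nabla_vector_field.
apply: funext => f; rewrite !fieldE/= ?fieldE; ring.
Qed.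

Lemma curvatureMr h X Y Z p : smooth_fun h -> vector_field X ->
  vector_field Y -> vector_field Z ->
  curv X Y (fun q => h q *: Z q) p = h p *: curv X Y Z p.
Proof.
move=> sh vX vY vZ; have vB := bracket_vector_field vX vY.
have vXZ := nabla_vector_field vX vZ; have vYZ := nabla_vector_field vY vZ.
have sYh : smooth_fun (fun q => Y q h) by have [_] := vY; apply => //;
  exact: openT.
have sXh : smooth_fun (fun q => X q h) by have [_] := vX; apply => //;
  exact: openT.
have hp : smooth_near p h by exists setT; split=> //; exact: openT.
have E W : (fun q => W q h *: Z q + h q *: nabla W Z q)
    = (fun q => W q h *: Z q) + (fun q => h q *: nabla W Z q) by [].
rewrite /curvature ![nabla _ (fun q => h q *: Z q)]nablaMr// !E.
rewrite !nablaDr//; try exact: vector_fieldM.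
rewrite ![nabla _ (fun q => h q *: nabla _ _ q)]nablaMr//.
rewrite [nabla X (fun q => Y q h *: Z q)]nablaMr//.
rewrite [nabla Y (fun q => X q h *: Z q)]nablaMr//.
apply: funext => f; rewrite !fieldE/= ?fieldE.
(* By convention a bracket is 0 on functions not smooth near [p], so smoothness of [h] is used here.
   The commutator absorbs the second derivatives of [h] left by the iterated Leibniz rule. *)
have -> : bracket X Y p h = X p (fun q => Y q h) - Y p (fun q => X q h).
  by rewrite /bracket /on_germs; case: asboolP.
ring.
Qed.

(** Makes the choice in [curvature_at] independent of the extensions. The arguments are exchanged
    one at a time, the second one through antisymmetry. *)
Lemma curvature_pointwise X Y Z X' Y' Z' p :
  vector_field X -> vector_field Y -> vector_field Z ->
  vector_field X' -> vector_field Y' -> vector_field Z' ->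
  X p = X' p -> Y p = Y' p -> Z p = Z' p -> curv X Y Z p = curv X' Y' Z' p.
Proof.
move=> vX vY vZ vX' vY' vZ' XX' YY' ZZ'.
have step A A' B C : vector_field A -> vector_field A' -> vector_field B ->
    vector_field C -> A p = A' p -> curv A B C p = curv A' B C p.
  move=> vA vA' vB vC; apply: (tensorial rmet lmet (p := p) (T := fun X =>
    curv X B C p)) => //.
    by move=> *; exact: curvatureDl.
  by move=> *; exact: curvatureMl.
rewrite (step X X' Y Z vX vX' vY vZ XX').
have -> : curv X' Y Z p = curv X' Y' Z p.
  rewrite (curvatureC vX' vY vZ) (curvatureC vX' vY' vZ).
  by congr (- _); exact: step.
apply: (tensorial rmet lmet (p := p) (T := fun Z => curv X' Y' Z p)) => //.
  by move=> *; exact: curvatureDr.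
by move=> *; exact: curvatureMr.
Qed.

Lemma curvature_at_left u v w p : lie_algebra u -> lie_algebra v ->
  lie_algebra w ->
  curvature_at nabla p (left_field u p) (left_field v p) (left_field w p)
  = Lpush p (ng u (ng v w) - ng v (ng u w) - ng (ng u v - ng v u) w).
Proof.
move=> lu lv lw.
have vu := left_field_vector_field lu; have vv := left_field_vector_field lv.
have vw := left_field_vector_field lw.
have <- : curv (left_field u) (left_field v) (left_field w) p
    = Lpush p (ng u (ng v w) - ng v (ng u w) - ng (ng u v - ng v u) w).
  have luv := nabla_lie_in lu lv; have lvu := nabla_lie_in lv lu.
  have lvw := nabla_lie_in lv lw; have luw := nabla_lie_in lu lw.
  rewrite /curvature torsion_free// !nabla_left_field//.
  rewrite (_ : left_field (ng u v) - left_field (ng v u) = left_field (ng u v -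
    ng v u))//.
  by rewrite nabla_left_field//; exact: tangentB.
apply: xget_unique.
  by exists (left_field u), (left_field v), (left_field w).
move=> y [X [Y [Z [[vX vY vZ] [Xu Yv Zw ->]]]]].
exact: curvature_pointwise.
Qed.

Lemma curvature_at_translate u v w p :
  lie_algebra u -> lie_algebra v -> lie_algebra w ->
  curvature_at nabla p (Lpush p u) (Lpush p v) (Lpush p w)
  = Lpush p (curvature_at nabla 1%g u v w).
Proof.
move=> lu lv lw; rewrite (curvature_at_left p lu lv lw).
have := curvature_at_left 1%g lu lv lw.
by rewrite /left_field !Lpush1 => ->.
Qed.

End Curvature.
End LeviCivita.

(** * Covariant derivatives in the left trivialization *)

Lemma is_pd_sum (R : realType) (E : diff_space R) (J : Type) (r : seq J)
    (f : J -> E -> R) (l : J -> R) i x : dbase x ->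
  (forall j, is_pd i (f j) x (l j)) ->
  is_pd i (fun y => \sum_(j <- r) f j y) x (\sum_(j <- r) l j).
Proof.
move=> bx fl; elim: r => [|j r IH].
  rewrite big_nil (_ : (fun y => _) = fun=> 0); first exact: is_pd_cst.
  by apply: funext => y; rewrite big_nil.
rewrite big_cons (_ : (fun y => _) = fun y => f j y + \sum_(j <- r) f j y).
  exact: is_pdD.
by apply: funext => y; rewrite big_cons.
Qed.

Section CurvesInLieAlgebra.
Context {R : realType} {n : nat} {G : lieGroupType R n}.
Variables (D : set R) (pD : dense_in_itself D).
Local Notation E := (within_space pD).
Local Notation curve := (curve_in_tangent D (1%g : G)).
Implicit Types (w u v : R -> tvec R G) (a : R -> R) (f : G -> R).

Let oD : dopen (E := E) D := @dopenT _ _ pD.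

Lemma smooth_withinP a : smooth_within D a <-> forall k, Ck_on (E := E) k D a.
Proof.
by split=> H k; [apply/(Ck_on_within k a oD)|apply/(Ck_on_within k a oD)];
  exact: H.
Qed.

Lemma smooth_within_derive a : smooth_within D a ->
  smooth_within D (derive_within D a).
Proof. by move=> H k; have [_ []] := H k.+1. Qed.

Lemma smooth_within_is_pd a t : smooth_within D a -> D t ->
  is_pd (E := E) tt a t (derive_within D a t).
Proof.
move=> /smooth_withinP aD Dt; rewrite (within_pdE a oD Dt).
exact: Ck_on_is_pd (aD 1%N) Dt.
Qed.

Lemma derive_withinE a t l : D t -> is_pd (E := E) tt a t l ->
  derive_within D a t = l.
Proof. by move=> Dt al; rewrite (within_pdE a oD Dt); exact: pdE. Qed.

Lemma is_pd_within_eq (a b : R -> R) t l : D t -> (forall s, D s ->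
  a s = b s) ->
  is_pd (E := E) tt a t l -> is_pd (E := E) tt b t l.
Proof.
move=> Dt ab; apply: near_is_pd => //; first exact: ab.
change (nbhs t (fun s => D s -> a s = b s)).
by apply: filterE.
Qed.

Lemma curve_tangent w t : curve w -> D t -> lie_algebra (w t).
Proof. by move=> [+ _]; exact. Qed.

(** [deriv_vec] is taken at every [f]. Where [f] is not smooth near the identity, tangent vectors
    vanish by convention, and the derivative is that of 0. *)
Lemma curve_is_pd w f t : curve w -> D t ->
  is_pd (E := E) tt (fun s => w s f) t (deriv_vec D w t f).
Proof.
move=> [tw sw] Dt; have [sf|nf] := pselect (smooth_near (1%g : G) f).
  by apply: smooth_within_is_pd => //; exact: sw.
have z : is_pd (E := E) tt (fun s => w s f) t 0.
  apply: (@is_pd_within_eq (fun=> 0)) => // [s Ds|]; last exact: is_pd_cst.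
  by rewrite (tangent_nonsmooth (tw s Ds) nf).
by rewrite /deriv_vec (derive_withinE Dt z).
Qed.

Lemma eq_curve w w' : (forall t, D t -> w t = w' t) -> curve w -> curve w'.
Proof.
move=> ww [tw sw]; split=> [t Dt|f sf]; first by rewrite -ww//; exact: tw.
apply/smooth_withinP => k; apply: (eq_Ck_on (E := E) (f := fun t => w t f)) =>
  //.
  by move=> t Dt; rewrite ww.
by have /smooth_withinP := sw f sf; exact.
Qed.

Lemma curve_comb (J : Type) (r : seq J) (a : J -> R -> R) (e : J -> tvec R G) :
  (forall j, smooth_within D (a j)) -> (forall j, lie_algebra (e j)) ->
  curve (fun t => \sum_(j <- r) a j t *: e j).
Proof.
move=> sa le; split=> [t Dt|f sf].
  by apply: tangent_sum => j _; exact: tangentZ (le j).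
apply/smooth_withinP => k.
rewrite (_ : (fun t => _) = fun t => \sum_(j <- r) a j t * e j f); last first.
  by apply: funext => t; rewrite fct_sumE.
apply: Ck_on_sum => // j; apply: Ck_onM => //; last exact: Ck_on_cst.
by have /smooth_withinP := sa j; exact.
Qed.

Lemma curve_coord w i : curve w -> smooth_within D (fun t => lie_coord i (w t)).
Proof.
move=> [_]; apply; apply: smooth_near_coord; first exact: unit_chart_atlas.
exact: unit_chart_dom.
Qed.

Lemma curve_coordE w t : curve w -> D t ->
  w t = \sum_i lie_coord i (w t) *: lie_basis i.
Proof. by move=> cw Dt; apply: lie_coordE; exact: curve_tangent. Qed.

(** A derivative of functionals is again a tangent vector because the curve stays in the span of a
    fixed finite basis and can be differentiated coefficientwise. *)
Lemma deriv_vec_coordE w t : curve w -> D t ->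
  deriv_vec D w t = \sum_i derive_within D (fun s =>
    lie_coord i (w s)) t *: lie_basis i.
Proof.
move=> cw Dt; apply: funext => f; rewrite fct_sumE; apply: derive_withinE => //.
apply: (@is_pd_within_eq (fun s => \sum_i lie_coord i (w s) * lie_basis i f))
  => //.
  by move=> s Ds; rewrite [in RHS](curve_coordE cw Ds) fct_sumE.
apply: is_pd_sum => // i; rewrite -[X in is_pd _ _ _ X]addr0.
rewrite -[X in _ + X](mulr0 (lie_coord i (w t))).
have si := curve_coord i cw.
apply: (@is_pdM _ E) => //; last exact: is_pd_cst.
  by have /smooth_withinP/(_ 0%N) := si => /Ck_on_cont; apply.
exact: smooth_within_is_pd.
Qed.

Lemma curve_deriv w : curve w -> curve (deriv_vec D w).
Proof.
move=> cw; apply: (@eq_curve (fun t => \sum_i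
    derive_within D (fun s => lie_coord i (w s)) t *: lie_basis i)).
  by move=> t Dt; rewrite -deriv_vec_coordE.
apply: curve_comb => i; last exact: lie_basis_in.
by apply: smooth_within_derive; exact: curve_coord.
Qed.

Lemma curveD u v : curve u -> curve v -> curve (fun t => u t + v t).
Proof.
move=> [tu su] [tv sv]; split=> [t Dt|f sf].
  by apply: tangentD; [exact: tu|exact: tv].
apply/smooth_withinP => k; apply: Ck_onD => //.
  by have /smooth_withinP := su f sf; exact.
by have /smooth_withinP := sv f sf; exact.
Qed.

Lemma deriv_vecD u v t : curve u -> curve v -> D t ->
  deriv_vec D (fun s => u s + v s) t = deriv_vec D u t + deriv_vec D v t.
Proof.
move=> cu cv Dt; apply: funext => f; apply: derive_withinE => //.
by apply: is_pdD => //; exact: curve_is_pd.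
Qed.

Section Connection.
Variables (met : G -> tvec R G -> tvec R G -> R)
  (nabla : (G -> tvec R G) -> (G -> tvec R G) -> (G -> tvec R G)).
Hypotheses (rmet : riemannian_metric met) (lmet : left_invariant met)
  (lc : levi_civita met nabla).
Local Notation ng := (nabla_lie nabla).

(** Bilinear expansion on constant vectors: all dependence on time is in products of coordinates,
    which yields both smoothness and the product rule. *)
Let nabla_lie_coordE u v t : curve u -> curve v -> D t ->
  ng (u t) (v t) = \sum_(ij : 'I_n * 'I_n)
    (lie_coord ij.1 (u t) * lie_coord ij.2 (v t)) *:
      ng (lie_basis ij.1) (lie_basis ij.2).
Proof.
move=> cu cv Dt; rewrite {1}(curve_coordE cu Dt).
rewrite (nabla_lie_suml lc); [|exact: lie_basis_in|exact: curve_tangent].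
rewrite -(pair_bigA _ (fun i j => (lie_coord i (u t) * lie_coord j (v t)) *:
  ng (lie_basis i) (lie_basis j)))/=; apply: eq_bigr => i _.
rewrite {1}(curve_coordE cv Dt) (nabla_lie_sumr lc).
- by rewrite scaler_sumr; apply: eq_bigr => j _; rewrite scalerA.
- exact: lie_basis_in.
- exact: lie_basis_in.
Qed.

Lemma curve_nabla_lie u v : curve u -> curve v ->
  curve (fun t => ng (u t) (v t)).
Proof.
move=> cu cv; apply: (@eq_curve (fun t => \sum_(ij : 'I_n * 'I_n)
    (lie_coord ij.1 (u t) * lie_coord ij.2 (v t)) *:
      ng (lie_basis ij.1) (lie_basis ij.2))).
  by move=> t Dt; rewrite -nabla_lie_coordE.
apply: (@curve_comb _ _ (fun ij t => lie_coord ij.1 (u t) * lie_coord ij.2 (v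
  t))).
  move=> ij; apply/smooth_withinP => k; apply: Ck_onM => //.
    by have /smooth_withinP := curve_coord ij.1 cu; exact.
  by have /smooth_withinP := curve_coord ij.2 cv; exact.
by move=> ij; apply: (nabla_lie_in lc); exact: lie_basis_in.
Qed.

Lemma deriv_vec_nabla_lie u v t : curve u -> curve v -> D t ->
  deriv_vec D (fun s => ng (u s) (v s)) t
  = ng (deriv_vec D u t) (v t) + ng (u t) (deriv_vec D v t).
Proof.
move=> cu cv Dt; have cu' := curve_deriv cu; have cv' := curve_deriv cv.
rewrite (nabla_lie_coordE cu' cv Dt) (nabla_lie_coordE cu cv' Dt) -big_split/=.
apply: funext => f; rewrite fct_sumE; apply: derive_withinE => //.
apply: (@is_pd_within_eq (fun s => \sum_(ij : 'I_n * 'I_n)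
    (lie_coord ij.1 (u s) * lie_coord ij.2 (v s)) *
      ng (lie_basis ij.1) (lie_basis ij.2) f)) => //.
  by move=> s Ds; rewrite (nabla_lie_coordE cu cv Ds) fct_sumE.
apply: is_pd_sum => // ij.
(* The derivative is put in the shape of the product rule with a constant last factor, whence the
   term multiplied by 0. *)
set e := ng _ _; rewrite [X in is_pd _ _ _ X](_ : _ =
    (lie_coord ij.1 (deriv_vec D u t) * lie_coord ij.2 (v t) +
     lie_coord ij.1 (u t) * lie_coord ij.2 (deriv_vec D v t)) * e f +
    (lie_coord ij.1 (u t) * lie_coord ij.2 (v t)) * 0); last first.
  by rewrite mulr0 addr0 mulrDl.
have cont i w : curve w -> cont_at (E := E) (fun s => lie_coord i (w s)) t.
  move=> cw; have /smooth_withinP/(_ 0%N) := curve_coord i cw.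
  by move=> /Ck_on_cont; apply.
apply: (@is_pdM _ E) => //; last exact: is_pd_cst.
  by apply: cvgM; exact: cont.
apply: (@is_pdM _ E) => //; first exact: cont.
  exact: curve_is_pd.
exact: curve_is_pd.
Qed.

Section Along.
Variables (Dt : (R -> G) -> (R -> tvec R G) -> (R -> tvec R G)) (g : R -> G).
Hypotheses (cDt : covariant_derivative nabla D Dt) (sg : smooth_curve D g).

Local Notation xi := (fun t => Lpush (g t)^-1%g (velocity D g t)).

Lemma left_velocity_in t : D t -> lie_algebra (xi t).
Proof. by move=> Dt'; apply: lie_algebra_Lpush; exact: velocity_tangent. Qed.

(* xi(t) f is the derivative at s = t of f (g(t)^-1 g(s)): in charts, a combination
   of partial derivatives of f (x^-1 y) restricted to the diagonal. *)
Lemma left_velocity_curve : curve xi.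
Proof.
split=> [t|f [U [oU U1 fU]]]; first exact: left_velocity_in.
apply/smooth_withinP => k; apply: Ck_on_local => t0 Dt0.
have [c ac ct0] := atlas_cover (g t0).
have /(smooth_curveP pD) sg' := sg; have [cg kg] := sg'.
pose S : set R := D `&` g @^-1` chart_dom c.
have oS : dopen (E := E) S.
  by apply: dopen_smooth_preimage => //; exact: chart_dom_open.
exists S => //.
pose inv (z : 'rV[R]_(n + n)) :=
  ((chart_inv c (lsubmx z))^-1 * chart_inv c (rsubmx z))%g.
have sinv : smooth_map (E := rV_space R (n + n)) (chart_pair c c) inv.
  have oc := open_dopen (@chart_pair_open _ _ _ c c).
  apply: (smooth_mapM (E := rV_space R (n + n))
    (F := fun z => (chart_inv c (lsubmx z))^-1%g) (K :=
      chart_inv c \o rsubmx)) => //.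
    apply: (smooth_mapV (E := rV_space R (n + n)) (F :=
      chart_inv c \o lsubmx)) => //.
    exact: smooth_lsubmx.
  exact: smooth_rsubmx.
pose W := chart_pair c c `&` inv @^-1` U.
have oW : open W.
  apply: dopen_rV; apply: dopen_smooth_preimage => //.
    exact/open_dopen/chart_pair_open.
  by have [] := sinv.
have Psi m : Ck_on (E := rV_space R (n + n)) m W (f \o inv).
  apply: (@smooth_map_comp _ (rV_space R (n + n)) _ _ _ _ U) => //.
  - exact: open_dopen.
  - by apply: smooth_map_sub sinv => z [].
  - by move=> z [].
pose cd j t := derive_within D (fun s => chart_map c (g s) 0 j) t.
apply: (@eq_Ck_on _ E _ _ (fun t => \sum_j cd j t *
   'D_(delta_mx 0 (rshift n j)) (f \o inv)
     (row_mx (chart_map c (g t)) (chart_map c (g t))))) => //.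
  move=> t [Dt' ct]; rewrite /Lpush (velocityE pD sg Dt' ac ct) /chart_vec
    /on_germs.
  case: asboolP => [_|]; last first.
    by case; apply/smooth_near_translate; rewrite mulVg; exists U.
  apply: eq_bigr => j _; rewrite mxE; congr (_ * _); rewrite -derive_row_mx.
  congr ('D_ _ _ _); apply: funext => z /=.
  by rewrite /inv row_mxKl row_mxKr chart_mapK.
apply: Ck_on_sum => // j; apply: Ck_onM => //.
  have [_ /(_ tt)[_]] := kg c ac j k.+1; apply: eq_Ck_on => //.
apply: (@Ck_on_comp _ E _ _ _ W (fun z =>
  'D_(delta_mx 0 (rshift n j)) (f \o inv) z)
  (fun t => row_mx (chart_map c (g t)) (chart_map c (g t)))) => //.
- move=> t [Dt' ct]; rewrite /W /chart_pair /inv /= row_mxKl row_mxKr.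
  split; last by rewrite chart_mapK// mulVg.
  by split; exact: chart_map_img.
- by have /Ck_on_rV [_ /(_ (rshift n j))[_]] := Psi k.+1.
move=> i; have [i' ->|i' ->] := split_ordP i.
  rewrite (_ : (fun y => _) = fun t => chart_map c (g t) 0 i'); first exact: kg.
  by apply: funext => t; rewrite row_mxEl.
rewrite (_ : (fun y => _) = fun t => chart_map c (g t) 0 i'); first exact: kg.
by apply: funext => t; rewrite row_mxEr.
Qed.

Lemma field_along_left w : curve w ->
  field_along D g (fun t => Lpush (g t) (w t)).
Proof.
move=> cw; split=> [t Dt'|U f oU fU].
  by apply: left_field_tangent; exact: curve_tangent.
have /(smooth_curveP pD) sg' := sg; have [cg _] := sg'.
have oS : dopen (E := E) (D `&` g @^-1` U) by exact: dopen_smooth_preimage.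
move=> k; apply/(Ck_on_within k _ oS).
apply: (@eq_Ck_on _ E _ _ (fun t => \sum_i lie_coord i (w t) *
    left_field (lie_basis i) (g t) f)) => //.
  move=> t [Dt' _]; rewrite [in RHS](curve_coordE cw Dt') Lpush_sum.
  by rewrite fct_sumE.
apply: Ck_on_sum => // i; apply: Ck_onM => //.
  have /smooth_withinP/(_ k) := curve_coord i cw.
  by apply: Ck_on_sub => t [].
apply: (@smooth_map_comp _ E _ _ _ g U (fun q =>
  left_field (lie_basis i) q f)) => //.
- by apply: smooth_map_sub sg' => t [].
- by move=> t [].
- by have [_] := left_field_vector_field (@lie_basis_in R n G i); exact.
Qed.

(** The field along the curve and the velocity at time [t] both extend to left-invariant fields, so
    the last axiom on [Dt] applies and the derivative is that of left-invariant fields. *)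
Lemma Dt_left_field (u : tvec R G) t : lie_algebra u -> D t ->
  Dt g (fun s => Lpush (g s) u) t = Lpush (g t) (ng (xi t) u).
Proof.
move=> lu Dt'; have [_ _ _ H] := cDt sg.
have vu := left_field_vector_field lu.
have lx := left_velocity_in Dt'; have vx := left_field_vector_field lx.
have cu : curve (fun=> u).
  split=> // f sf; apply/smooth_withinP => k; exact: Ck_on_cst.
rewrite (H _ _ (field_along_left cu) vu _ _ t Dt' vx)//; last first.
  by rewrite /left_field LpushVK.
by rewrite (nabla_left_field rmet lmet lc).
Qed.

Lemma Dt0 t : D t -> Dt g 0 t = 0.
Proof.
move=> Dt'; have := Dt_left_field (@tangent0 R n G 1%g) Dt'.
have -> : ng (xi t) 0 = 0.
  have := nabla_lieZr lc 0 (left_velocity_in Dt') (@tangent0 R n G 1%g).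
  by rewrite !scale0r.
exact.
Qed.

Lemma Dt_comb (J : Type) (r : seq J) (a : J -> R -> R) (e : J -> tvec R G) t :
  (forall j, smooth_within D (a j)) -> (forall j, lie_algebra (e j)) -> D t ->
  Dt g (fun s => Lpush (g s) (\sum_(j <- r) a j s *: e j)) t
  = Lpush (g t) (\sum_(j <- r) derive_within D (a j) t *: e j
      + ng (xi t) (\sum_(j <- r) a j t *: e j)).
Proof.
move=> sa le Dt'; have lx := left_velocity_in Dt'.
rewrite (nabla_lie_sumr lc)// -big_split/=.
have [_ HD HM _] := cDt sg.
elim: r => [|j r IH].
  rewrite big_nil (_ : (fun s => _) = 0); first exact: Dt0.
  by apply: funext => s; rewrite big_nil.
have ce : curve (fun=> e j).
  split=> [? _|f sf]; first exact: le.
  by apply/smooth_withinP => k; exact: Ck_on_cst.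
have caj : curve (fun s => a j s *: e j).
  have := @curve_comb _ [:: j] a e sa le; apply: eq_curve => s _.
  by rewrite big_seq1.
rewrite (_ : (fun s => _) = (fun s => Lpush (g s) (a j s *: e j))
    + (fun s => Lpush (g s) (\sum_(j <- r) a j s *: e j))); last first.
  by apply: funext => s; rewrite big_cons.
rewrite HD//; [|exact: field_along_left|exact/field_along_left/curve_comb].
rewrite IH big_cons.
rewrite (HM (a j) (fun s => Lpush (g s) (e j)) (sa j) (field_along_left ce) t
  Dt').
by rewrite Dt_left_field.
Qed.

(* [Dt] only sees the values on [D]: the last axiom of covariant derivatives, applied
   to the zero vector field, kills the fields that vanish on [D]. *)
Lemma Dt_left w W t : curve w -> (forall s, D s -> W s = Lpush (g s) (w s)) ->
  D t -> Dt g W t = Lpush (g t) (deriv_vec D w t + ng (xi t) (w t)).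
Proof.
move=> cw WE Dt'; have [_ HD _ H4] := cDt sg.
pose z s := Lpush (g s)^-1%g (W s) - \sum_i lie_coord i (w s) *: lie_basis i.
have z0 s : D s -> z s = 0.
  by move=> Ds; rewrite /z WE// LpushK -curve_coordE// subrr.
have cz : curve z.
  apply: (@eq_curve (fun=> 0)) => [s Ds|]; first by rewrite z0.
  split=> [s _|f sf]; first exact: tangent0.
  by apply/smooth_withinP => k; exact: Ck_on_cst.
have WE' : W = (fun s => Lpush (g s) (\sum_i lie_coord i (w s) *: lie_basis i))
    + (fun s => Lpush (g s) (z s)).
  apply: funext => s; rewrite -[RHS]/(Lpush (g s) (_ + z s)).
  by rewrite /z addrC subrK LpushVK.
have sc i := curve_coord i cw.
rewrite WE' HD//; last 2 first.
- by apply: field_along_left; apply: curve_comb => // i; exact: lie_basis_in.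
- exact: field_along_left.
have lx := left_velocity_in Dt'.
rewrite (H4 _ 0 (field_along_left cz) (vector_field0 (G := G)) _ _ t Dt'
  (left_field_vector_field lx)); last 2 first.
- by move=> s Ds; rewrite z0.
- by rewrite /left_field LpushVK.
have := nablaZr lc 0 (left_field_vector_field lx) (vector_field0 (G := G)).
rewrite !scale0r => ->; rewrite addr0.
rewrite Dt_comb//; last by move=> i; exact: lie_basis_in.
by rewrite -deriv_vec_coordE// -curve_coordE.
Qed.

End Along.
End Connection.
End CurvesInLieAlgebra.

(** * The gradient and the spline operator at the identity *)

Lemma grad_left_reduction (R : realType) (n : nat) (G : lieGroupType R n)
    (met bi : G -> tvec R G -> tvec R G -> R) (beta : tvec R G -> tvec R G)
    (V : G -> R) (g0 : G) (Vext : G * G -> R) (p : G) :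
  riemannian_metric met -> left_invariant met ->
  riemannian_metric bi -> left_invariant bi -> lie_endomorphism beta ->
  (forall xi eta : tvec R G, lie_algebra xi -> lie_algebra eta ->
    bi 1%g xi eta = met 1%g (beta xi) eta) ->
  (forall x, Vext (x, g0) = V x) ->
  (forall x y z : G, Vext ((z * x)%g, (z * y)%g) = Vext (x, y)) ->
  grad met V p = Lpush p (beta (Lpush (g0^-1 * p)^-1%g
    (grad bi (fun x => Vext (x, 1%g)) (g0^-1 * p)%g))).
Proof.
move=> rmet lmet rbi lbi [lbeta _] bimet VV Vinv.
set h := (g0^-1 * p)%g; set F := fun x => Vext (x, 1%g).
have [tV VE] := gradP rmet lmet V p; have [tF FE] := gradP rbi lbi F h.
have lk := lie_algebra_Lpush tF; set k := Lpush h^-1%g _ in lk *.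
have lbk := lbeta _ lk.
apply: (met_inj rmet tV) => [|w tw].
  exact: (left_field_tangent p lbk).
rewrite VE// (tangent_left_field p w); have lw := lie_algebra_Lpush tw.
move: (Lpush p^-1%g w) lw => z lz; rewrite -[Lpush p (beta k)]/(left_field
  (beta k) p).
rewrite (met_left_field lmet p lbk lz) -bimet// -(met_left_field lbi h lk lz).
have -> : left_field k h = grad bi F h by rewrite /left_field LpushVK.
rewrite FE; last exact: left_field_tangent.
rewrite /left_field /Lpush; congr (z _); apply: funext => y.
(* Invariance under translation by [g0] turns the second argument 1 into [g0], where [Vext] is
   [V]. *)
by rewrite /F /h -(Vinv _ _ g0) mulg1 !mulgA mulgV mul1g VV.
Qed.

(** In the third covariant derivative, [ng xi eta'] arises once from the product rule and once from
    the connection term, whence the factor 2. The product rule also yields [ng xi' eta], which the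
    equation for [xi'] splits into the terms with [eta] and with [ad_dagger]. *)
Lemma spline_operator_left (R : realType) (n : nat) (G : lieGroupType R n)
    (met : G -> tvec R G -> tvec R G -> R)
    (nabla : (G -> tvec R G) -> (G -> tvec R G) -> (G -> tvec R G))
    (D : set R) (pD : dense_in_itself D)
    (Dt : (R -> G) -> (R -> tvec R G) -> (R -> tvec R G))
    (g : R -> G) (eta : R -> tvec R G) (t : R) :
  riemannian_metric met -> left_invariant met -> levi_civita met nabla ->
  covariant_derivative nabla D Dt -> smooth_curve D g ->
  let g' := velocity D g in
  let xi := fun t => Lpush (g t)^-1%g (g' t) in
  let ng := nabla_lie nabla in
  curve_in_tangent D (1%g : G) eta ->
  (forall s, D s -> deriv_vec D xi s = eta s + ad_dagger met (xi s) (xi s)) ->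
  D t ->
  Dt g (Dt g (Dt g g')) t + curvature_at nabla (g t) (Dt g g' t) (g' t) (g' t)
  = Lpush (g t) (deriv_vec D (deriv_vec D eta) t
      + 2 *: ng (xi t) (deriv_vec D eta t) + ng (eta t) (eta t)
      + ng (ad_dagger met (xi t) (xi t)) (eta t)
      + ng (xi t) (ng (xi t) (eta t))
      + curvature_at nabla 1%g (eta t) (xi t) (xi t)).
Proof.
move=> rmet lmet lc cDt sg g' xi ng ceta xi_eta Dt'.
have cxi : curve_in_tangent D (1%g : G) xi by exact: left_velocity_curve.
have lxi s : D s -> lie_algebra (xi s) by exact: curve_tangent.
have leta s : D s -> lie_algebra (eta s) by exact: curve_tangent.
have gE s : D s -> g' s = Lpush (g s) (xi s) by rewrite /xi LpushVK.
have D1 s : D s -> Dt g g' s = Lpush (g s) (eta s).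
  move=> Ds; rewrite (Dt_left pD rmet lmet lc cDt sg cxi gE Ds) xi_eta//.
  by rewrite (ad_daggerE rmet lmet lc (lxi s Ds)) subrK.
have c2 : curve_in_tangent D (1%g : G) (fun s =>
  deriv_vec D eta s + ng (xi s) (eta s)).
  by apply: (curveD pD); [exact: curve_deriv|exact: (curve_nabla_lie pD lc)].
have D2 s : D s -> Dt g (Dt g g') s
    = Lpush (g s) (deriv_vec D eta s + ng (xi s) (eta s)).
  by move=> Ds; rewrite (Dt_left pD rmet lmet lc cDt sg ceta D1 Ds).
have ceta' := curve_deriv pD ceta.
rewrite (Dt_left pD rmet lmet lc cDt sg c2 D2 Dt') D1// gE//.
rewrite (curvature_at_translate rmet lmet lc (g t) (leta t Dt') (lxi t Dt')
  (lxi t Dt')).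
rewrite -[LHS]/(Lpush (g t) (_ + curvature_at nabla 1%g _ _ _)).
congr (Lpush _ (_ + _)).
rewrite (deriv_vecD pD)//; last exact: (curve_nabla_lie pD lc).
rewrite (deriv_vec_nabla_lie pD lc)// xi_eta//.
have lad : lie_algebra (ad_dagger met (xi t) (xi t)).
  rewrite (ad_daggerE rmet lmet lc (lxi t Dt')); apply: tangentN.
  by apply: (nabla_lie_in lc); exact: lxi.
rewrite (nabla_lieDl lc (leta t Dt') lad (leta t Dt')).
have leta' : lie_algebra (deriv_vec D eta t) by exact: curve_tangent ceta' Dt'.
have lng := nabla_lie_in lc (lxi t Dt') (leta t Dt').
rewrite -/xi (nabla_lieDr lc (lxi t Dt') leta' lng).
rewrite -/ng; apply: funext => f.
have vecD (u v : tvec R G) : (u + v) f = u f + v f by [].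
have vecZ r (u : tvec R G) : (r *: u) f = r * u f by [].
by rewrite !(vecD, vecZ); ring.
Qed.

Theorem proposition3p9 (R : realType) (n : nat) (G : lieGroupType R n)
    (met bi : G -> tvec R G -> tvec R G -> R)
    (nabla : (G -> tvec R G) -> (G -> tvec R G) -> (G -> tvec R G))
    (beta : tvec R G -> tvec R G)
    (V : G -> R) (g0 : G) (Vext : G * G -> R)
    (a b : R)
    (Dt : (R -> G) -> (R -> tvec R G) -> (R -> tvec R G))
    (qa qb : G) (va vb : tvec R G) (g : R -> G) :
  connected [set: G] ->
  riemannian_metric met -> left_invariant met ->
  riemannian_metric bi -> left_invariant bi -> right_invariant bi ->
  lie_endomorphism beta ->
  (forall xi eta : tvec R G, lie_algebra xi -> lie_algebra eta ->
    bi 1%g xi eta = met 1%g (beta xi) eta) ->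
  levi_civita met nabla ->
  smooth_fun V -> (forall x, 0 <= V x) ->
  smooth_on_prod setT Vext ->
  (forall x, Vext (x, g0) = V x) ->
  (forall x y z : G, Vext ((z * x)%g, (z * y)%g) = Vext (x, y)) ->
  a < b ->
  covariant_derivative nabla `[a, b] Dt ->
  tangent qa va -> tangent qb vb ->
  Omega a b qa va qb vb g ->
  let g' := velocity `[a, b] g in
  let D := Dt g in
  let xi := fun t => Lpush (g t)^-1%g (g' t) in
  let h := fun t => (g0^-1 * g t)%g in
  let ng := nabla_lie nabla in
  (smooth_curve `[a, b] g /\
   forall t, t \in `[a, b] ->
     D (D (D g')) t + curvature_at nabla (g t) (D g' t) (g' t) (g' t)
     + grad met V (g t) = 0)
  <->
  (exists eta : R -> tvec R G,
    [/\ curve_in_tangent `[a, b] (1%g : G) xi,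
        curve_in_tangent `[a, b] (1%g : G) eta,
        smooth_curve `[a, b] h &
        forall t, t \in `[a, b] ->
        [/\ deriv_vec `[a, b] xi t = eta t + ad_dagger met (xi t) (xi t),
            0 = deriv_vec `[a, b] (deriv_vec `[a, b] eta) t
                + 2 *: ng (xi t) (deriv_vec `[a, b] eta t)
                + ng (eta t) (eta t)
                + ng (ad_dagger met (xi t) (xi t)) (eta t)
                + ng (xi t) (ng (xi t) (eta t))
                + curvature_at nabla 1%g (eta t) (xi t) (xi t)
                + beta (Lpush (h t)^-1%g
                          (grad bi (fun x => Vext (x, 1%g)) (h t))) &
            velocity `[a, b] h t = Lpush (h t) (xi t)]]).
Proof.
move=> _ rmet lmet rbi lbi _ lbeta bimet lc _ _ _ VV Vinv ab cDt _ _ _ g' D xi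
  h ng.
have pD := segment_dense_in_itself ab.
have gradE t := grad_left_reduction (g t) rmet lmet rbi lbi lbeta bimet VV Vinv.
have gE : g = (fun t => g0 * h t)%g.
  by apply: funext => t; rewrite /h mulgA mulgV mul1g.
(* Stated for an arbitrary [eta] obeying the first equation, so that both directions follow by
   cancelling the invertible [Lpush (g t)] or applying it. *)
have core eta : smooth_curve `[a, b] g ->
  curve_in_tangent `[a, b] (1%g : G) eta ->
    (forall s, s \in `[a, b] ->
      deriv_vec `[a, b] xi s = eta s + ad_dagger met (xi s) (xi s)) ->
    forall t, t \in `[a, b] ->
      D (D (D g')) t + curvature_at nabla (g t) (D g' t) (g' t) (g' t)
        + grad met V (g t)
      = Lpush (g t) (deriv_vec `[a, b] (deriv_vec `[a, b] eta) t
                + 2 *: ng (xi t) (deriv_vec `[a, b] eta t)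
                + ng (eta t) (eta t)
                + ng (ad_dagger met (xi t) (xi t)) (eta t)
                + ng (xi t) (ng (xi t) (eta t))
                + curvature_at nabla 1%g (eta t) (xi t) (xi t)
                + beta (Lpush (h t)^-1%g
                          (grad bi (fun x => Vext (x, 1%g)) (h t)))).
  move=> sg ceta xi_eta t tab; rewrite gradE.
  by rewrite (spline_operator_left pD rmet lmet lc cDt sg ceta xi_eta tab).
split=> [[sg eqg]|[eta [cxi ceta sh eqs]]].
  have cxi : curve_in_tangent `[a, b] (1%g :
    G) xi by exact: left_velocity_curve.
  (* The only possible choice, the first equation being solved for [eta] with [ad_dagger met xi xi]
     equal to [- ng xi xi]. *)
  pose eta t := deriv_vec `[a, b] xi t + ng (xi t) (xi t).
  have ceta : curve_in_tangent `[a, b] (1%g : G) eta.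
    by apply: (curveD pD); [exact: curve_deriv|exact: (curve_nabla_lie pD lc)].
  have xi_eta s : s \in `[a, b] ->
      deriv_vec `[a, b] xi s = eta s + ad_dagger met (xi s) (xi s).
    move=> sab; have lxi : lie_algebra (xi s) by exact: curve_tangent cxi sab.
    by rewrite (ad_daggerE rmet lmet lc lxi) addrK.
  exists eta; split=> //; first exact: smooth_curve_translate.
  move=> t tab; split; first exact: xi_eta.
    have := eqg t tab; rewrite (core eta)// => /(congr1 (Lpush (g t)^-1%g)).
    by rewrite LpushK => ->.
  by rewrite /h velocity_translate /xi LpushM mulgK.
have sg : smooth_curve `[a, b] g by rewrite gE; exact: smooth_curve_translate.
split=> // t tab; rewrite (core eta)//; last first.
  by move=> s sab; have [] := eqs s sab.
by have [_ <- _] := eqs t tab.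
Qed.
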